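(* Let $\Omega$ be a bounded open convex set in $\mathbb{R}^d$, and let $\varphi:\bar\Omega\to\mathbb{R}$ be continuous. Assume $\varphi$ is locally affine a.e. in $\Omega$, and let $A=\{x\in\Omega:\varphi\text{ is affine on a neighborhood of }x\}$. Also assume $\varphi$ is non-convex. Let $t>0$ and define the sets $$\mathcal{B}_t=\nabla\psi_t(A\cap\Theta_t^{\mathrm{o}}),\qquad \mathcal{S}_t=\nabla\psi_t^{**}(A\setminus\Theta_t^{\mathrm{o}}).$$ Then the Monge-Ampère measure $\kappa_t$ for $\psi_t^*$ has the (Lebesgue) decomposition $$\kappa_t=\mu_t+\nu_t\quad\text{where}\quad \mu_t=\lambda\llcorner\mathcal{B}_t,\quad \nu_t=\kappa_t\llcorner\mathcal{S}_t.$$ In addition: (i) the sets $\mathcal{B}_t$ and $\mathcal{S}_t$ are disjoint; (ii) the map $\nabla\psi_t:A\cap\Theta_t^{\mathrm{o}}\to\mathcal{B}_t$ is bijective and is locally a rigid translation; (iii) $\lambda(\mathcal{S}_t)=0$ and $\kappa_t(\mathcal{S}_t)>0$.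
   Context: $\lambda$ is Lebesgue measure on $\mathbb{R}^d$, and $\mu\llcorner S$ denotes the restriction of a measure $\mu$ to $S$. A function is locally affine a.e. in $\Omega$ if, for a.e. $x\in\Omega$, it is affine on some neighborhood of $x$. For $t>0$, $\psi_t(z)=\frac12|z|^2+t\varphi(z)$ for $z\in\bar\Omega$ and $\psi_t=+\infty$ outside $\bar\Omega$. $f^*(x)=\sup_{z\in\mathbb{R}^d}(x\cdot z-f(z))$ is the Legendre transform and $f^{**}=(f^* )^*$. The touching set is $\Theta_t=\{y\in\bar\Omega:\psi_t(y)=\psi_t^{**}(y)\}$ and $\Theta_t^{\mathrm{o}}$ denotes its interior. $\nabla\psi_t^{**}(S)$ denotes the image under $\nabla\psi_t^{**}$ of the points of $S$ at which $\psi_t^{**}$ is differentiable. The Monge-Ampère measure $\kappa_t$ for $\psi_t^*$ is the Borel measure on $\mathbb{R}^d$ given by $\kappa_t(B)=\lambda\big(\bigcup_{x\in B}\partial\psi_t^*(x)\big)$ for Borel sets $B$, where $\partial$ denotes the subdifferential of a convex function. *)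

(* Defs.v *)
From HB Require Import structures.
From mathcomp Require Import all_boot all_order all_algebra.
From mathcomp Require Import all_classical all_reals all_analysis.

Set Implicit Arguments.
Unset Strict Implicit.
Unset Printing Implicit Defensive.
Import Order.TTheory GRing.Theory Num.Theory.
Import numFieldNormedType.Exports.

Local Open Scope classical_set_scope.
Local Open Scope ring_scope.

Notation borelRd R d := (g_sigma_algebraType (@open 'rV[R]_d)).

Section LebesgueMeasure.
Context {R : realType} {d : nat}.
Local Open Scope ereal_scope.

Definition box (a b : 'rV[R]_d) : set 'rV[R]_d :=
  [set x | forall i, (a ord0 i <= x ord0 i <= b ord0 i)%R].

(* Sets that are neither empty nor a box get volume +oo: in an infimum over
   countable covers by Borel sets, only the covers by boxes then matter. *)
Definition box_volume (S : set (borelRd R d)) : \bar R :=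
  if `[< S = set0 >] then 0 else
  ereal_inf [set (\prod_(i < d) (ab.2 ord0 i - ab.1 ord0 i))%R%:E
    | ab in [set ab : 'rV[R]_d * 'rV[R]_d | (forall i, ab.1 ord0 i <= ab.2 ord0 i)%R
                      /\ S = box ab.1 ab.2]].

(* Lebesgue outer measure, defined on all sets; it is the Lebesgue measure on
   the sets that are measurable in the sense of Caratheodory. *)
Definition lebesgue (X : set (borelRd R d)) : \bar R := mu_ext box_volume X.

Lemma box_volume0 : box_volume set0 = 0.
Proof. by rewrite /box_volume asboolT. Qed.

Lemma box_volume_ge0 S : 0 <= box_volume S.
Proof.
rewrite /box_volume; case: asboolP => // _.
apply: le_ereal_inf_tmp => _ [[a b] /= [ab _] <-].
by rewrite lee_fin prodr_ge0// => i _; rewrite subr_ge0.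
Qed.

HB.instance Definition _ := isOuterMeasure.Build R (borelRd R d) lebesgue
  (mu_ext0 box_volume0 box_volume_ge0) (mu_ext_ge0 box_volume_ge0)
  (le_mu_ext box_volume) (mu_ext_sigma_subadditive box_volume_ge0).

End LebesgueMeasure.

Section ConvexAnalysis.
Context {R : realType} {d : nat}.
Implicit Types (x z p : 'rV[R]_d) (f : 'rV[R]_d -> \bar R).

Definition dot x z : R := \sum_(i < d) x ord0 i * z ord0 i.

Definition legendre f x : \bar R :=
  ereal_sup [set ((dot x z)%:E - f z)%E | z in [set: 'rV[R]_d]].

Definition subdifferential f x : set 'rV[R]_d :=
  [set p | forall z, (f x + (dot p (z - x))%:E <= f z)%E].

Definition ereal_differentiable f x : Prop :=
  (\forall z \near x, f z \is a fin_num) /\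
  differentiable (fun z => fine (f z) : R^o) x.

(* The gradient of f at its points of differentiability. *)
Definition grad f x : 'rV[R]_d :=
  \row_i 'D_(delta_mx ord0 i) (fun z => fine (f z) : R^o) x.

Definition grad_image f (S : set 'rV[R]_d) : set 'rV[R]_d :=
  grad f @` (S `&` [set x | ereal_differentiable f x]).

Definition monge_ampere f (B : set 'rV[R]_d) : \bar R :=
  lebesgue (\bigcup_(x in B) subdifferential f x).

Definition affine_near (phi : 'rV[R]_d -> R) x : Prop :=
  exists p c, \forall z \near x, phi z = dot p z + c.

End ConvexAnalysis.

Section TouchingSet.
Context {R : realType} {d : nat}.
Variables (Omega : set 'rV[R]_d) (phi : 'rV[R]_d -> R).

Definition affine_set : set 'rV[R]_d :=
  [set x | Omega x /\ affine_near phi x].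

Definition locally_affine_ae : Prop :=
  lebesgue (Omega `\` affine_set) = 0%E.

Variable t : R.

Definition psi (z : 'rV[R]_d) : \bar R :=
  if `[< closure Omega z >] then (2^-1 * dot z z + t * phi z)%:E else +oo%E.

Definition psi_star2 : 'rV[R]_d -> \bar R := legendre (legendre psi).

Definition touching_set : set 'rV[R]_d :=
  [set y | closure Omega y /\ psi y = psi_star2 y].

Definition B_set : set 'rV[R]_d :=
  grad_image psi (affine_set `&` interior touching_set).

Definition S_set : set 'rV[R]_d :=
  grad_image psi_star2 (affine_set `\` interior touching_set).

(* The Monge-Ampere measure of psi_t^*, as a function on all sets. *)
Definition kappa : set 'rV[R]_d -> \bar R := monge_ampere (legendre psi).

End TouchingSet.

(* Main.v *)
From HB Require Import structures.
Require Import Defs.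
From mathcomp Require Import all_boot all_order all_algebra.
From mathcomp Require Import all_classical all_reals all_analysis.
From mathcomp Require Import measurable_realfun ring lra.
Import Order.TTheory GRing.Theory Num.Theory.
Import numFieldNormedType.Exports.
Local Open Scope classical_set_scope.
Local Open Scope ring_scope.

(** Let [f] be the conjugate of [psi_t] and write [p \in df(x)] for the
    subdifferential relation.  It is closed and monotone, so only a null set of
    [p] is related to several [x], and conversely: if C1 and C2 are compact sets
    of points x separated along an axis, then df(C1) and df(C2) have at most one
    common point on each parallel to that axis, hence df(C1) `&` df(C2) has
    infinitely many disjoint translates inside a bounded region.

    Above the interior of the touching set, psi_t is locally |z|^2/2 plus an
    affine function and [df] inverts its gradient, which is locally a
    translation; this is the absolutely continuous part.  At almost every other
    [p] in [Omega] the biconjugate is differentiable, and its gradient [x] must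
    have several points in [df(x)], so that these [x] form a null set.

    The singular part does not vanish: if all of [Omega] were touching, psi_t
    would be convex.  By Fubini almost every parallel translate of a segment
    meets the non-affine set in a null set; along such a segment the slope of
    psi_t is nondecreasing and locally a homothety, so it grows at least as
    fast as that of |z|^2/2, and phi is convex along the segment. *)

(** The delicate point is measurability. [kappa] is the outer measure of an image under the
    subdifferential, and neither such an image nor [S_set] is visibly Borel. Discarding the null set
    of those p that are related to several x makes the inverse relation a partial function, so that
    the image of E becomes an inverse image: it respects relative complements, countable unions and
    disjointness, and it is Borel for Borel E. Since Caratheodory's criterion splits arbitrary sets
    along Borel pieces, intersecting these images with the image of [S_set] still gives a countably
    additive function. The Borel null set that carries it is the set of all x related to several p,
    which contains [S_set]. *)

Set Implicit Arguments.
Unset Strict Implicit.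
Unset Printing Implicit Defensive.

(** * Lebesgue outer measure on row vectors *)

Section Boxes.
Context {R : realType} {d : nat}.
Implicit Types (a b x : 'rV[R]_d).

Lemma coord_le_norm x i : `|x ord0 i| <= `|x|.
Proof.
rewrite [leRHS]/Num.norm /= mx_normrE; apply/bigmax_geP; right => /=.
by exists (ord0, i).
Qed.

Lemma norm_le_coord x (e : R) :
  0 <= e -> (forall i, `|x ord0 i| <= e) -> `|x| <= e.
Proof.
move=> e0 xe; rewrite [leLHS]/Num.norm /= mx_normrE; apply/bigmax_leP.
by split => // -[i j] _ /=; rewrite ord1.
Qed.

(** A total sequence: codes that decode to nothing give the empty set, so that local properties turn
    into countable unions over [k]. *)
Definition rational_box (k : nat) : set 'rV[R]_d :=
  if (unpickle k : option ('rV[rat]_d * 'rV[rat]_d)) is Some ab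
  then box (map_mx ratr ab.1) (map_mx ratr ab.2) else set0.

Lemma nbhs_box a b x : (forall i, a ord0 i < x ord0 i < b ord0 i) ->
  nbhs x (box a b).
Proof.
move=> axb.
have H i : \forall y \near nbhs x, a ord0 i < (y : 'rV[R]_d) ord0 i < b ord0 i.
  have /andP[ax xb] := axb i.
  have cx : {for x, continuous (fun y : 'rV[R]_d => y ord0 i)}.
    exact: coord_continuous.
  near=> y; apply/andP; split; near: y.
    exact: (cvgr_gt (x ord0 i)).
  exact: (cvgr_lt (x ord0 i)).
have : nbhs x [set y : 'rV[R]_d | forall i, a ord0 i < y ord0 i < b ord0 i].
  exact: (@filter_forall _ _ _ (nbhs x)).
apply: filterS => y ayb i.
by have /andP[/ltW -> /ltW ->] := ayb i.
Unshelve. all: by end_near. Qed.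

Lemma rational_box_nbhs x (U : set 'rV[R]_d) : nbhs x U ->
  exists k, nbhs x (rational_box k) /\ rational_box k `<=` U.
Proof.
move=> /nbhs_ballP[e /= e0 eU].
have /choice[a aP] (i : 'I_d) : exists q : rat,
    x ord0 i - e < ratr q < x ord0 i.
  have /rat_in_itvoo[q] : x ord0 i - e < x ord0 i by rewrite ltrBlDr ltrDl.
  by rewrite in_itv /=; exists q.
have /choice[b bP] (i : 'I_d) : exists q : rat,
    x ord0 i < ratr q < x ord0 i + e.
  have /rat_in_itvoo[q] : x ord0 i < x ord0 i + e by rewrite ltrDl.
  by rewrite in_itv /=; exists q.
exists (pickle (\row_i a i, \row_i b i)).
rewrite /rational_box pickleK /=; split.
  apply: nbhs_box => i; rewrite !mxE.
  by have /andP[_ ->] := aP i; have /andP[-> _] := bP i.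
move=> y aby; apply: eU; split => // i j; rewrite ord1 /ball /=.
have := aby j; rewrite !mxE => /andP[ay yb].
have /andP[ae _] := aP j; have /andP[_ be] := bP j.
rewrite ltr_norml; apply/andP; split; lra.
Qed.

End Boxes.

Section LebesgueOuterMeasure.
Context {R : realType} {d : nat}.
Implicit Types (a b x : 'rV[R]_d).
Local Notation lam := (@lebesgue R d).

Lemma box_volume_box a b : (forall i, a ord0 i <= b ord0 i) ->
  box_volume (box a b) = (\prod_(i < d) (b ord0 i - a ord0 i))%:E.
Proof.
move=> ab; rewrite /box_volume asboolF; last first.
  by move=> /seteqP[+ _] => /(_ a); apply => i; rewrite lexx ab.
rewrite (_ : [set _ | _ in _] = [set (\prod_(i < d) (b ord0 i - a ord0 i))%:E]).
  by rewrite ereal_inf1.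
apply/seteqP; split => [_ [[a' b'] /= [ab' E] <-]|_ ->]; last first.
  by exists (a, b).
congr (_ %:E); apply: eq_bigr => i _.
have /(_ i)/andP[h1 h2] : box a' b' a by rewrite -E => j; rewrite lexx ab.
have /(_ i)/andP[h3 h4] : box a' b' b by rewrite -E => j; rewrite lexx ab.
have /(_ i)/andP[h5 h6] : box a b a' by rewrite E => j; rewrite lexx ab'.
have /(_ i)/andP[h7 h8] : box a b b' by rewrite E => j; rewrite lexx ab'.
by congr (_ - _); apply/eqP; rewrite eq_le ?h1 ?h4 ?h5 ?h8.
Qed.

Variant box_volume_spec (S : set (borelRd R d)) : \bar R -> Prop :=
  | BoxVolumeInfinite : box_volume_spec S +oo%E
  | BoxVolumeEmpty of S = set0 : box_volume_spec S 0%E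
  | BoxVolumeBox a b of (forall i, a ord0 i <= b ord0 i) & S = box a b :
      box_volume_spec S (\prod_(i < d) (b ord0 i - a ord0 i))%:E.

Lemma box_volumeP S : box_volume_spec S (box_volume S).
Proof.
have [->|S0] := pselect (S = set0).
  by rewrite box_volume0; exact: BoxVolumeEmpty.
have [[a [b [ab ->]]]|noab] := pselect (exists a b,
    (forall i, a ord0 i <= b ord0 i) /\ S = box a b).
  by rewrite box_volume_box//; exact: BoxVolumeBox.
rewrite /box_volume asboolF// (_ : [set _ | _ in _] = set0).
  by rewrite ereal_inf0; exact: BoxVolumeInfinite.
by rewrite -subset0 => _ [[a b] /= abS _]; apply: noab; exists a, b.
Qed.

(** Maximality of the outer measure generated by boxes. Inequalities for all sets are thereby
    checked on boxes alone; half-space splitting and scaling both come from it. *)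
Lemma lebesgue_dominates (m : set 'rV[R]_d -> \bar R) :
  m set0 = 0%E -> {homo m : X Y / X `<=` Y >-> (X <= Y)%E} ->
  sigma_subadditive m ->
  (forall a b, (forall i, a ord0 i <= b ord0 i) ->
     (m (box a b) <= (\prod_(i < d) (b ord0 i - a ord0 i))%:E)%E) ->
  forall X, (m X <= lam X)%E.
Proof.
move=> m0 le_m sub_m box_m X.
have m_ge0 Y : (0 <= m Y)%E by rewrite -m0; exact: le_m.
apply: le_ereal_inf_tmp => _ [A [mA XA] <-].
apply: (le_trans (le_m _ _ XA)); apply: (le_trans (sub_m _)).
apply: lee_nneseries => // k _.
case: box_volumeP => [|->|a b ab ->]; [exact: leey|by rewrite m0|exact: box_m].
Qed.

Lemma lebesgue_sigma_subadditive : sigma_subadditive lam.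
Proof. exact: outer_measure_sigma_subadditive. Qed.

Lemma le_lebesgue X Y : X `<=` Y -> (lam X <= lam Y)%E.
Proof. exact: le_mu_ext. Qed.

Lemma lebesgue_ge0 X : (0 <= lam X)%E.
Proof. exact: outer_measure_ge0. Qed.

Lemma lebesgue_bigcup0 (F : (set 'rV[R]_d)^nat) :
  (forall k, lam (F k) = 0%E) -> lam (\bigcup_k F k) = 0%E.
Proof.
move=> F0; apply/eqP; rewrite eq_le lebesgue_ge0 andbT.
by rewrite (le_trans (lebesgue_sigma_subadditive F))// eseries0.
Qed.

Lemma lebesgue_sub0 X Y : X `<=` Y -> lam Y = 0%E -> lam X = 0%E.
Proof.
move=> XY Y0; apply/eqP; rewrite eq_le lebesgue_ge0 andbT -Y0.
exact: le_lebesgue.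
Qed.

Lemma lebesgueU_le X Y : (lam (X `|` Y) <= lam X + lam Y)%E.
Proof. exact: outer_measureU2. Qed.

Lemma lebesgue_setU0 X Y : lam X = 0%E -> lam Y = 0%E -> lam (X `|` Y) = 0%E.
Proof.
move=> X0 Y0; apply/eqP; rewrite eq_le lebesgue_ge0 andbT.
by rewrite (le_trans (lebesgueU_le _ _))// X0 Y0 adde0.
Qed.

Lemma eq_lebesgue_mod0 X Y N : lam N = 0%E ->
  X `<=` Y `|` N -> Y `<=` X `|` N -> lam X = lam Y.
Proof.
move=> N0 XY YX; apply/eqP; rewrite eq_le; apply/andP; split.
- rewrite (le_trans (le_lebesgue XY))// (le_trans (lebesgueU_le _ _))//.
  by rewrite N0 adde0.
- rewrite (le_trans (le_lebesgue YX))// (le_trans (lebesgueU_le _ _))//.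
  by rewrite N0 adde0.
Qed.

Lemma measurable_closed (A : set 'rV[R]_d) : closed A ->
  measurable (A : set (borelRd R d)).
Proof.
move=> cA; rewrite -(setCK A); apply: measurableC; apply: sub_sigma_algebra.
exact: closed_openC.
Qed.

Lemma measurable_open (A : set 'rV[R]_d) : open A ->
  measurable (A : set (borelRd R d)).
Proof. exact: sub_sigma_algebra. Qed.

Lemma closed_halfspace_le (c : R) i : closed [set x : 'rV[R]_d | x ord0 i <= c].
Proof.
apply: (@preimage_closed _ _ (fun x : 'rV[R]_d => x ord0 i)) (@closed_le R c).
by move=> x _; exact: coord_continuous.
Qed.

Lemma closed_halfspace_ge (c : R) i : closed [set x : 'rV[R]_d | c <= x ord0 i].
Proof.
apply: (@preimage_closed _ _ (fun x : 'rV[R]_d => x ord0 i)) (@closed_ge R c).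
by move=> x _; exact: coord_continuous.
Qed.

Lemma boxE a b : box a b =
  \bigcap_i ([set x | a ord0 i <= x ord0 i] `&` [set x | x ord0 i <= b ord0 i]).
Proof.
apply/seteqP; split => [x xab i _|x xab i]; first by have /andP := xab i.
by have [] := xab i Logic.I => /= -> ->.
Qed.

Lemma closed_box a b : closed (box a b).
Proof.
rewrite boxE; apply: closed_bigI => i _.
by apply: closedI; [exact: closed_halfspace_ge|exact: closed_halfspace_le].
Qed.

Lemma measurable_box a b : measurable (box a b : set (borelRd R d)).
Proof. by apply: measurable_closed; exact: closed_box. Qed.

Lemma lebesgue_box_le a b : (forall i, a ord0 i <= b ord0 i) ->
  (lam (box a b) <= (\prod_(i < d) (b ord0 i - a ord0 i))%:E)%E.
Proof.
move=> ab; rewrite -box_volume_box//; apply: ereal_inf_lbound.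
exists (fun k => if k == 0%N then box a b : set (borelRd R d) else set0).
  split=> [[|k]//=|x abx]; last by exists 0%N.
  exact: measurable_box.
rewrite (nneseries_split 0%N 1%N)/=; last by move=> *; exact: box_volume_ge0.
rewrite big_nat1 eseries0 ?adde0// => -[|k]//= _ _; exact: box_volume0.
Qed.

(** Truncating the sides at 0 admits inverted boxes, which are empty, and so spares a case
    distinction when a hyperplane cuts a box. *)
Lemma le_lebesgue_box_setI X a b :
  (lam (X `&` box a b) <= (\prod_(i < d) Num.max 0 (b ord0 i - a ord0 i))%:E)%E.
Proof.
have [ab|] := pselect (forall i, a ord0 i <= b ord0 i).
  under eq_bigr => i _ do rewrite max_r ?subr_ge0//.
  by apply: le_trans (lebesgue_box_le ab); apply: le_lebesgue; exact: subIsetr.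
move=> /existsNP[i /negP]; rewrite -ltNge => ba.
rewrite (_ : X `&` box a b = set0).
  rewrite /lebesgue mu_ext0 ?lee_fin ?prodr_ge0//.
  - by move=> j _; rewrite le_max lexx.
  - exact: box_volume0.
  - exact: box_volume_ge0.
rewrite -subset0 => x [_ /(_ i)/andP[ax /(le_trans ax)]].
by rewrite leNgt ba.
Qed.

Lemma lebesgue_set0 : lam set0 = 0%E.
Proof. by rewrite /lebesgue mu_ext0//; [exact: box_volume0|exact: box_volume_ge0]. Qed.

Lemma sigma_subadditive_setI X : sigma_subadditive (fun Y => lam (Y `&` X)).
Proof.
move=> F; rewrite setI_bigcupl; exact: lebesgue_sigma_subadditive.
Qed.

(** Sending X to the sum of the measures of its two parts is itself countably subadditive, so by
    [lebesgue_dominates] the bound is needed only for boxes. *)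
Lemma lebesgue_halfspace_caratheodory (c : R) i :
  lam.-caratheodory [set x : 'rV[R]_d | x ord0 i <= c].
Proof.
apply: le_caratheodory_measurable => X; set H := [set _ | _].
apply: (@lebesgue_dominates (fun X => lam (X `&` H) + lam (X `&` ~` H))%E).
- by rewrite !set0I !lebesgue_set0 adde0.
- by move=> A B AB; apply: leeD; apply: le_lebesgue; exact: setSI.
- move=> F; rewrite nneseriesD; last 2 first.
    by move=> *; exact: lebesgue_ge0.
    by move=> *; exact: lebesgue_ge0.
  by apply: leeD; exact: sigma_subadditive_setI.
- move=> a b ab.
  (* The box is cut at height [c]: [b'] lowers the upper corner, [a'] raises the lower one. If [c]
     misses the side, one part is inverted and has truncated volume 0. *)
  pose b' := \row_j (if j == i then Num.min (b ord0 i) c else b ord0 j).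
  pose a' := \row_j (if j == i then Num.max (a ord0 i) c else a ord0 j).
  have le1 : (lam (box a b `&` H) <=
      (\prod_(j < d) Num.max 0 (b' ord0 j - a ord0 j))%:E)%E.
    rewrite (_ : _ `&` H = setT `&` box a b'); first exact: le_lebesgue_box_setI.
    rewrite setTI; apply/seteqP; split => [x [xab Hx] j|x xab].
      rewrite mxE; case: eqP => [->|_]; last exact: xab.
      by have /andP[-> /= xb] := xab i; rewrite le_min xb.
    split=> [j|].
      have /andP[-> /=] := xab j; rewrite mxE; case: eqP => [->|_]//.
      by rewrite le_min => /andP[].
    have /andP[_] := xab i; rewrite mxE eqxx le_min => /andP[_].
    by [].
  have le2 : (lam (box a b `&` ~` H) <=
      (\prod_(j < d) Num.max 0 (b ord0 j - a' ord0 j))%:E)%E.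
    apply: le_trans (le_lebesgue_box_setI setT a' b).
    apply: le_lebesgue; rewrite setTI => x [xab /negP Hx] j.
    have /andP[ax ->] := xab j; rewrite andbT mxE; case: eqP => [ji|//].
    by rewrite -ji ge_max ax /= ji ltW// ltNge.
  apply: (le_trans (leeD le1 le2)); rewrite -EFinD lee_fin.
  rewrite (bigD1 i)//= [X in _ + X](bigD1 i)//= [leRHS](bigD1 i)//= !mxE !eqxx.
  rewrite (eq_bigr (fun j => b ord0 j - a ord0 j)); last first.
    by move=> j /negbTE ji; rewrite mxE ji max_r// subr_ge0.
  rewrite [X in _ + _ * X](eq_bigr (fun j => b ord0 j - a ord0 j)); last first.
    by move=> j /negbTE ji; rewrite mxE ji max_r// subr_ge0.
  rewrite -mulrDl ler_wpM2r ?prodr_ge0//.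
    by move=> j _; rewrite subr_ge0.
  have := ab i.
  rewrite !maxEle !minEle; do 4 case: ifP => //; rewrite -?ltNge; lra.
Qed.

Lemma lebesgue_caratheodory (A : set (borelRd R d)) : measurable A ->
  lam.-caratheodory A.
Proof.
have Hge (c : R) i : lam.-caratheodory [set x : 'rV[R]_d | c <= x ord0 i].
  rewrite (_ : mkset _ =
      \bigcap_k ~` [set x : 'rV[R]_d | x ord0 i <= c - k.+1%:R^-1]).
    rewrite -[X in _ X]setCK setC_bigcap.
    apply: caratheodory_measurable_setC; apply: caratheodory_measurable_bigcup.
    by move=> k; rewrite setCK; exact: lebesgue_halfspace_caratheodory.
  apply/seteqP; split => [x /= cx k _ /=|x /= cx].
    apply/negP; rewrite -ltNge; apply: lt_le_trans cx.
    by rewrite ltrBlDr ltrDl invr_gt0.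
  rewrite leNgt; apply/negP => xc.
  have [k kc] : exists k : nat, k.+1%:R^-1 < c - x ord0 i.
    have /ltr_add_invr[k] : x ord0 i < c by [].
    by rewrite addrC -ltrBrDr; exists k.
  by apply: (cx k Logic.I) => /=; rewrite lerBrDr -lerBrDl ltW.
have Hbox (a b : 'rV[R]_d) : lam.-caratheodory (box a b).
  pose F (i : 'I_d) := [set x : 'rV[R]_d | a ord0 i <= x ord0 i] `&`
          [set x | x ord0 i <= b ord0 i].
  suff -> : box a b = ~` \bigcup_k (if insub k is Some i then ~` F i else set0).
    apply: caratheodory_measurable_setC; apply: caratheodory_measurable_bigcup.
    move=> k; case: insubP => [i _ _|_].
      apply: caratheodory_measurable_setC; apply: caratheodory_measurable_setI.
        exact: Hge.
      exact: lebesgue_halfspace_caratheodory.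
    exact: caratheodory_measurable_set0.
  rewrite boxE; apply/seteqP; split => [x xab [k _]|x nx i _].
    by case: insubP => // i _ _; apply; exact: xab.
  apply: contrapT => xi; apply: nx; exists i => //.
  by rewrite valK.
have Hrat k : lam.-caratheodory (rational_box k).
  rewrite /rational_box; case: unpickle => [ab|].
    exact: Hbox.
  exact: caratheodory_measurable_set0.
apply: (@smallest_sub _ (sigma_algebra setT)).
  split.
  - exact: caratheodory_measurable_set0.
  - by move=> B cB; rewrite setTD; exact: caratheodory_measurable_setC.
  - by move=> F cF; exact: caratheodory_measurable_bigcup.
move=> U oU.
rewrite (_ : U = \bigcup_k
    (if `[< rational_box k `<=` U >] then rational_box k else set0)).
  apply: caratheodory_measurable_bigcup => k; case: asboolP => // _.
  exact: caratheodory_measurable_set0.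
apply/seteqP; split => [x Ux|x [k _]]; last by case: asboolP => // + xk; exact.
have [k [xk kU]] := rational_box_nbhs (open_nbhs_nbhs (conj oU Ux)).
by exists k => //; rewrite asboolT//; exact: nbhs_singleton.
Qed.

End LebesgueOuterMeasure.

(* Induction on [n], integrating over the last coordinate the bound for slices. *)
Lemma unit_cube_cover {R : realType} n (P : pred nat) (a b : nat -> nat -> R) :
  (forall k i, P k -> a k i <= b k i) ->
  (forall x : nat -> R, (forall i, (i < n)%N -> 0 <= x i <= 1) ->
     exists k, P k /\ forall i, (i < n)%N -> a k i <= x i <= b k i) ->
  (1 <= \sum_(0 <= k <oo | P k) (\prod_(i < n) (b k i - a k i))%:E)%E.
Proof.
elim: n P => [|n IH] P ab cover.
  have [|k [Pk _]] := cover (fun=> 0); first by [].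
  rewrite (@nneseriesD1 _ _ k)//=; last by move=> j Pj; rewrite big_ord0 lee_fin.
  by rewrite big_ord0 leeDl// nneseries_ge0// => j _ _; rewrite big_ord0 lee_fin.
have vol_ge0 k : P k -> 0 <= \prod_(i < n) (b k i - a k i).
  by move=> Pk; rewrite prodr_ge0// => i _; rewrite subr_ge0 ab.
pose D01 : set (measurableTypeR R) := `[0%R, 1%R]%classic.
pose I k : set (measurableTypeR R) := `[a k n, b k n]%classic.
pose w k : R := if P k then \prod_(i < n) (b k i - a k i) else 0.
have w_ge0 k : 0 <= w k by rewrite /w; case: ifPn => // /vol_ge0.
pose mu := @lebesgue_measure R.
have mI k : measurable (I k) by exact: measurable_itv.
have mD : measurable D01 by exact: measurable_itv.
have m1 k : measurable_fun D01
    (fun s : measurableTypeR R => (w k * \1_(I k) s)%:E : \bar R).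
  apply/measurable_EFinP; apply: (@measurable_funM _ _ _ _ (cst (w k))) => //.
(* The boxes whose last side contains [s] cover the slice at height [s]; restricting [P] selects
   them for the induction hypothesis. *)
have slice s : s \in D01 ->
    (1 <= \sum_(k <oo) (w k * \1_(I k) s)%:E)%E.
  rewrite inE /D01 /= in_itv/= => s01.
  rewrite (le_trans (IH (fun k => P k && (s \in `[a k n, b k n])) _ _))//.
  - by move=> k i /andP[Pk _]; exact: ab.
  - move=> x x01.
    have [|k [Pk kx]] := cover (fun i => if i == n then s else x i).
      move=> i; rewrite ltnS leq_eqVlt; case: eqP => [//|_ /=]; exact: x01.
    exists k; split.
      by rewrite Pk/= in_itv/=; have := kx n (ltnSn n); rewrite eqxx.
    move=> i i_n; have := kx i (ltnW i_n).
    by rewrite ltn_eqF.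
  - rewrite eseries_mkcond lee_nneseries// => k _.
      by case: ifPn => // /andP[/vol_ge0]; rewrite lee_fin.
    rewrite /w indicE; case: ifPn => [/andP[-> ks]|_].
      by rewrite mem_set// mulr1.
    by rewrite lee_fin mulr_ge0//; case: ifPn => // /vol_ge0.
have -> : (1 = \int[mu]_(s in D01) (cst 1 s))%E.
  have muD : mu D01 = 1%E.
    by rewrite /mu /D01 lebesgue_measure_itv /= lte_fin ltr01 oppr0 adde0.
  by rewrite integral_cst// mul1e; exact/esym/muD.
apply: (@le_trans _ _ (\int[mu]_(s in D01)
    (\sum_(k <oo) (w k * \1_(I k) s)%:E)))%E.
  apply: ge0_le_integral => //.
  - apply: ge0_emeasurable_sum => // k s _ _.
    by rewrite lee_fin mulr_ge0.
  - by move=> s s01; apply: slice; rewrite inE.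
rewrite integral_nneseries//; last first.
  by move=> k s _; rewrite lee_fin mulr_ge0.
rewrite [leRHS]eseries_mkcond lee_nneseries// => k _.
  by move=> _; apply: integral_ge0 => s _; rewrite lee_fin mulr_ge0.
under eq_integral do rewrite EFinM.
rewrite ge0_integralZl//; last 2 first.
  by apply/measurable_EFinP; exact: measurable_indic.
  by rewrite lee_fin.
rewrite integral_indic// /w; case: ifPn => [Pk|_]; last by rewrite mul0e.
rewrite big_ord_recr/= EFinM lee_wpmul2l ?lee_fin ?vol_ge0//.
apply: (@le_trans _ _ (mu (I k))).
  by apply: le_measure; rewrite ?inE//; exact: measurableI.
rewrite /mu /I lebesgue_measure_itv /= lte_fin; case: ifPn => //.
by rewrite lee_fin subr_ge0 ab.
Qed.

(** * Additivity and scaling of Lebesgue measure *)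

Section LebesgueMeasureTheory.
Context {R : realType}.

(** Applied to the part of [Y] inside the union, the criterion for the pieces leaves no remainder.
    The set [Y] is arbitrary, and will be the image of [S_set] under the subdifferential. *)
Lemma lebesgue_setI_bigcup {d} (F : (set (borelRd R d))^nat) (Y : set (borelRd R d)) :
  (forall k, (@lebesgue R d).-caratheodory (F k)) -> trivIset setT F ->
  lebesgue (Y `&` \bigcup_k F k) = (\sum_(k <oo) lebesgue (Y `&` F k))%E.
Proof.
move=> mF tF; apply/eqP; rewrite eq_le; apply/andP; split.
  rewrite setI_bigcupr; exact: lebesgue_sigma_subadditive.
have := @caratheodory_lime_le _ _ (@lebesgue R d) F mF tF (Y `&` \bigcup_k F k).
rewrite -setIA setICr setI0 outer_measure0 adde0; apply: le_trans.
apply: lee_nneseries => [k _ _|k _]; first exact: lebesgue_ge0.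
by apply: le_lebesgue => x [Yx Fx]; split=> //; split => //; exists k.
Qed.

Lemma lebesgue_bigcup {d} (F : (set (borelRd R d))^nat) :
  (forall k, (@lebesgue R d).-caratheodory (F k)) -> trivIset setT F ->
  lebesgue (\bigcup_k F k) = (\sum_(k <oo) lebesgue (F k))%E.
Proof.
move=> mF tF; rewrite -[X in lebesgue X]setTI lebesgue_setI_bigcup//.
by apply: eq_eseriesr => k _; rewrite setTI.
Qed.

Lemma measure_of_additive {d} (m : set (borelRd R d) -> \bar R) :
  m set0 = 0%E -> (forall A, (0 <= m A)%E) -> semi_sigma_additive m ->
  exists mu : {measure set (borelRd R d) -> \bar R}, forall A, mu A = m A.
Proof.
move=> m0 m_ge0 m_add.
pose M := isMeasure.Build _ _ R m m0 m_ge0 m_add.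
pose mu : {measure set (borelRd R d) -> \bar R} := HB.pack m M.
by exists mu.
Qed.

(** [D] behaves like an inverse image, so additivity passes to the composite. It is instantiated
    with the identity and with images under the subdifferential, cleared of ambiguous points. *)
Lemma measure_lebesgue_setI {d} (D : set (borelRd R d) -> set (borelRd R d))
    (Y : set (borelRd R d)) :
  D set0 = set0 ->
  (forall E, measurable E -> (@lebesgue R d).-caratheodory (D E)) ->
  (forall F : (set (borelRd R d))^nat, D (\bigcup_k F k) = \bigcup_k D (F k)) ->
  (forall E F, E `&` F = set0 -> D E `&` D F = set0) ->
  exists mu : {measure set (borelRd R d) -> \bar R},
    forall E, mu E = lebesgue (Y `&` D E).
Proof.
move=> D0 mD DU DI; apply: measure_of_additive.
- by rewrite D0 setI0 lebesgue_set0.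
- by move=> A; exact: lebesgue_ge0.
- move=> F mF tF _.
  have tDF : trivIset setT (D \o F).
    apply/trivIsetP => i j _ _ ij; apply: DI; by move/trivIsetP : tF; apply.
  rewrite DU lebesgue_setI_bigcup//; last by move=> k; exact: mD.
  have := @is_cvg_nneseries _ (fun k => lebesgue (Y `&` D (F k))) predT 0.
  by apply => *; exact: lebesgue_ge0.
Qed.

Section MeasureInstance.
Context {d : nat}.

Lemma lebesgue_semi_sigma_additive : semi_sigma_additive (@lebesgue R d).
Proof.
move=> F mF tF _; rewrite lebesgue_bigcup//.
  have := @is_cvg_nneseries _ (fun k => lebesgue (F k)) predT 0.
  by apply => *; exact: lebesgue_ge0.
by move=> k; exact: lebesgue_caratheodory.
Qed.

HB.instance Definition _ := isMeasure.Build _ (borelRd R d) R lebesgue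
  lebesgue_set0 lebesgue_ge0 lebesgue_semi_sigma_additive.

Lemma lebesgue_sigma_finite : sigma_finite setT (@lebesgue R d).
Proof.
pose c (k : nat) : 'rV[R]_d := const_mx k%:R.
exists (fun k => box (- c k) (c k)).
  apply/esym/seteqP; split => // x _.
  have [k xk] : exists k : nat, `|x| < k%:R.
    by exists (Num.bound `|x|); exact: archi_boundP.
  exists k => // i; rewrite !mxE -ler_norml (le_trans _ (ltW xk))//.
  exact: coord_le_norm.
move=> k; split; first exact: measurable_box.
rewrite (le_lt_trans (lebesgue_box_le _)) ?ltry// => i.
by rewrite !mxE (le_trans (y := 0)) ?oppr_le0.
Qed.

HB.instance Definition _ := Measure_isSigmaFinite.Build _ (borelRd R d) R lebesgue
  lebesgue_sigma_finite.

End MeasureInstance.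

Lemma measurable_preimage_continuous {m n} (f : 'rV[R]_m -> 'rV[R]_n)
    (E : set (borelRd R n)) :
  continuous f -> measurable E -> measurable (f @^-1` E : set (borelRd R m)).
Proof.
move=> cf; apply: (@smallest_sub _ (sigma_algebra setT) _
    [set E : set (borelRd R n) | measurable (f @^-1` E : set (borelRd R m))]).
  split => /=.
  - by rewrite preimage_set0.
  - by move=> A mA; rewrite setTD preimage_setC; exact: measurableC.
  - by move=> F mF; rewrite preimage_bigcup; exact: (@bigcupT_measurable _ (borelRd R m)).
by move=> U oU; apply: measurable_open; apply: open_comp => // x _; exact: cf.
Qed.

Section Homothety.
Context {d : nat}.
Local Notation hom r v := (fun x : 'rV[R]_d => r *: x + v).

Lemma hom_preimage (r : R) v (X : set 'rV[R]_d) : 0 < r ->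
  hom r v @` X = hom r^-1 (- (r^-1 *: v)) @^-1` X.
Proof.
move=> r0; have rn0 : r != 0 by rewrite gt_eqF.
apply/seteqP; split => [_ [x Xx <-]/=|y /= Xy].
  by rewrite scalerDr addrK scalerA mulVf// scale1r.
exists (r^-1 *: y - r^-1 *: v) => //.
by rewrite scalerBr !scalerA mulfV// !scale1r subrK.
Qed.

Lemma hom_continuous (r : R) v : continuous (hom r v).
Proof.
move=> x.
apply: (@cvgD _ _ _ (nbhs x) _ (fun x => r *: x) (fun=> v) (r *: x) v).
  by apply: cvgZ; [exact: cvg_cst|exact: cvg_id].
exact: cvg_cst.
Qed.

(** The rescaled measure of the image is countably subadditive and at most the volume on boxes, so
    [lebesgue_dominates] applies. The inverse homothety then yields equality in [lebesgue_hom]. *)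
Lemma lebesgue_hom_le (r : R) v (X : set 'rV[R]_d) : 0 < r ->
  (lebesgue (hom r v @` X) <= (r ^+ d)%:E * lebesgue X)%E.
Proof.
move=> r0; have rd0 : 0 < r ^+ d by rewrite exprn_gt0.
have rdV : (0 <= ((r ^+ d)^-1)%:E)%E by rewrite lee_fin invr_ge0 ltW.
rewrite -lee_pdivrMl//.
apply: (@lebesgue_dominates _ _
   (fun X => ((r ^+ d)^-1)%:E * lebesgue (hom r v @` X))%E).
- by rewrite image_set0 lebesgue_set0 mule0.
- by move=> A B AB; rewrite lee_wpmul2l// le_lebesgue//; exact: image_subset.
- move=> F; rewrite nneseriesZl; last by move=> *; exact: lebesgue_ge0.
  rewrite lee_wpmul2l// image_bigcup; exact: lebesgue_sigma_subadditive.
- move=> a b ab; rewrite lee_pdivrMl// -EFinM.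
  apply: (@le_trans _ _ (lebesgue (box (r *: a + v) (r *: b + v)))).
    apply: le_lebesgue => _ [x abx <-] i; rewrite !mxE !lerD2r.
    by rewrite !ler_pM2l//; exact: abx.
  apply: le_trans (lebesgue_box_le _) _.
    by move=> i; rewrite !mxE lerD2r ler_pM2l.
  have -> : r ^+ d = \prod_(i < d) r by rewrite prodr_const card_ord.
  rewrite lee_fin -big_split/=.
  apply: ler_prod => i _; rewrite !mxE; apply/andP; split.
    by rewrite subr_ge0 lerD2r ler_pM2l.
  by rewrite le_eqVlt; apply/orP; left; apply/eqP; ring.
Qed.

Lemma lebesgue_hom (r : R) v (X : set 'rV[R]_d) : 0 < r ->
  lebesgue (hom r v @` X) = ((r ^+ d)%:E * lebesgue X)%E.
Proof.
move=> r0; apply/eqP; rewrite eq_le lebesgue_hom_le//=.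
have rd0 : 0 < r ^+ d by rewrite exprn_gt0.
have rV0 : 0 < r^-1 by rewrite invr_gt0.
have := @lebesgue_hom_le r^-1 (- (r^-1 *: v)) (hom r v @` X) rV0.
rewrite (_ : _ @` (_ @` X) = X); first by rewrite exprVn lee_pdivlMl.
have homK x : r^-1 *: (r *: x + v) - r^-1 *: v = x.
  by rewrite scalerDr addrK scalerA mulVf ?gt_eqF// scale1r.
apply/seteqP; split => [_ [_ [x Xx <-] <-]|x Xx]; first by rewrite homK.
by exists (r *: x + v); [exists x|rewrite homK].
Qed.

Lemma lebesgue_translation v (X : set 'rV[R]_d) :
  lebesgue ((fun x => x + v) @` X) = lebesgue X.
Proof.
rewrite -[RHS]mul1e -(expr1n R d) -(@lebesgue_hom 1 v)//.
by congr (lebesgue (_ @` X)); apply/funext => x; rewrite scale1r.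
Qed.

Lemma measurable_hom (r : R) v (X : set (borelRd R d)) : 0 < r ->
  measurable X -> measurable (hom r v @` X : set (borelRd R d)).
Proof.
move=> r0 mX; rewrite hom_preimage//.
by apply: measurable_preimage_continuous => //; exact: hom_continuous.
Qed.

(** Countably many disjoint Borel pieces of [U] carry one homothety each, and injectivity keeps
    their Borel images disjoint. Both sides are summed along these pieces, which allows an arbitrary
    [X] in [U]. *)
Lemma lebesgue_piecewise_hom (r : R) (U : set 'rV[R]_d) (T : 'rV[R]_d -> 'rV[R]_d) :
  0 < r -> open U -> {in U &, injective T} ->
  (forall x, U x -> exists v, \forall y \near x, T y = r *: y + v) ->
  forall X, X `<=` U -> lebesgue (T @` X) = ((r ^+ d)%:E * lebesgue X)%E.
Proof.
move=> r0 oU injT homT X XU.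
pose good k := exists v, rational_box k `<=` U `&` [set y | T y = r *: y + v].
pose V k : set (borelRd R d) := if `[< good k >] then rational_box k else set0.
have mV k : measurable (V k).
  rewrite /V; case: asboolP => // _; rewrite /rational_box.
  by case: unpickle => [ab|//]; exact: measurable_box.
pose W := seqDU V.
have mW k : measurable (W k) by exact: (@seqDU_measurable _ (borelRd R d)).
have XW : X = X `&` \bigcup_k W k.
  apply/esym/setIidPl => x /XU Ux; rewrite -seqDU_bigcup_eq.
  have [v vT] := homT _ Ux.
  have xUv : nbhs x (U `&` [set y | T y = r *: y + v]).
    by apply: filterI => //; exact: open_nbhs_nbhs.
  have [k [xk kU]] := rational_box_nbhs xUv.
  exists k => //; rewrite /V asboolT; first exact: nbhs_singleton xk.
  by exists v.
have WT k : W k `<=` U /\ exists v, forall y, W k y -> T y = r *: y + v.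
  have WV : W k `<=` V k by exact: subset_seqDU.
  move: WV; rewrite /V; case: asboolP => [[v kU] WV|_ WV].
    by split => [x /WV/kU[]//|]; exists v => x /WV/kU[].
  by split => [x /WV|]//; exists 0 => x /WV.
have hom_sub k Y : Y `<=` W k -> exists v, T @` Y = hom r v @` Y.
  move=> YW; have [_ [v vT]] := WT k; exists v.
  by apply: eq_imagel => x /YW; exact: vT.
have TXW : T @` X = T @` X `&` \bigcup_k (T @` W k).
  apply/esym/setIidPl => _ [x Xx <-]; move: Xx; rewrite XW => -[_ [k _ Wx]].
  by exists k => //; exists x.
have tTW : trivIset setT (fun k => T @` W k).
  apply/trivIsetP => i j _ _ ij; rewrite -subset0 => _ [[x Wx <-] [y Wy]].
  move=> /injT -/(_ _ _)/= yx.
  have {}yx : y = x by apply: yx; rewrite inE; [apply (WT j).1|apply (WT i).1].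
  have := trivIset_seqDU V => /trivIsetP/(_ i j Logic.I Logic.I ij)/seteqP[+ _].
  by apply; split; [exact: Wx|rewrite -yx].
have mTW k : measurable (T @` W k : set (borelRd R d)).
  by have [v ->] := hom_sub k _ (@subset_refl _ _); exact: measurable_hom.
rewrite [in LHS]TXW lebesgue_setI_bigcup//; last first.
  by move=> k; exact: lebesgue_caratheodory.
rewrite [in RHS]XW lebesgue_setI_bigcup//; last 2 first.
- by move=> k; exact: lebesgue_caratheodory.
- exact: trivIset_seqDU.
rewrite -nneseriesZl; last by move=> *; exact: lebesgue_ge0.
apply: eq_eseriesr => k _.
have -> : T @` X `&` T @` W k = T @` (X `&` W k).
  apply/seteqP; split => [_ [[x Xx <-] [y Wy yx]]|_ [x [Xx Wx] <-]]; last first.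
    by split; exists x.
  have {}yx : y = x by apply: injT => //; rewrite inE; [exact: (WT k).1|exact: XU].
  by exists x => //; split => //; rewrite -yx.
have [|v ->] := hom_sub k (X `&` W k); first exact: subIsetr.
by rewrite lebesgue_hom.
Qed.

End Homothety.

(** Unless some member has volume +oo, a cover consists of boxes and empty sets; dropping the empty
    ones leaves a cover to which [unit_cube_cover] applies. *)
Lemma lebesgue_unit_cube d :
  (1 <= @lebesgue R d (box 0%R (const_mx 1%R)))%E.
Proof.
apply: le_ereal_inf_tmp => _ [A [mA cA] <-].
have [[k Ak]|noo] := pselect (exists k, box_volume (A k) = +oo%E).
  rewrite (eseries_pinfty _ _ Ak) ?leey// => n _.
  by rewrite gt_eqF// (lt_le_trans _ (box_volume_ge0 _)).
have /choice[ab abP] k : exists ab : 'rV[R]_d * 'rV[R]_d, A k !=set0 ->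
    [/\ forall i, ab.1 ord0 i <= ab.2 ord0 i, A k = box ab.1 ab.2 &
     box_volume (A k) = (\prod_(i < d) (ab.2 ord0 i - ab.1 ord0 i))%:E].
  case: box_volumeP (fun h => noo (ex_intro _ k h)) => [/(_ erefl)//|A0 _|a b le_ab E _].
    by exists 0; rewrite A0 => -[].
  by exists (a, b).
pose P k := `[< A k !=set0 >].
(* The default 0 beyond the last coordinate keeps [a k i <= b k i] true for every natural number
   [i]. *)
pose crd (x : 'rV[R]_d) (i : nat) := if insub i is Some j then x ord0 j else 0.
have crdE x (i : 'I_d) : crd x i = x ord0 i by rewrite /crd valK.
apply: (@le_trans _ _ (\sum_(0 <= k <oo | P k)
    (\prod_(i < d) (crd (ab k).2 i - crd (ab k).1 i))%:E)%E).
  apply: (unit_cube_cover (a := fun k => crd (ab k).1) (b := fun k => crd (ab k).2)).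
    move=> k i /asboolP/abP[le_ab _ _]; rewrite /crd; case: insubP => // j _ _.
  move=> x x01; have /cA[k _ Ak] : box 0 (const_mx 1) (\row_(i < d) x i).
    by move=> i; rewrite !mxE; exact: x01.
  exists k; split; first by apply/asboolP; eexists; exact: Ak.
  have [_ AE _] := abP k (ex_intro _ _ Ak); move: Ak; rewrite AE => Ak i i_d.
  have := Ak (Ordinal i_d); rewrite mxE -!crdE.
  by [].
rewrite eseries_mkcond; apply: lee_nneseries => [k _ _|k _].
  case: ifPn => // /asboolP/abP[le_ab _ _]; rewrite lee_fin prodr_ge0// => i _.
  by rewrite !crdE subr_ge0.
case: ifPn => [/asboolP/abP[_ _ ->]|_]; last exact: box_volume_ge0.
by under eq_bigr do rewrite !crdE.
Qed.

Lemma lebesgue_cube d (a : 'rV[R]_d) (r : R) : 0 < r ->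
  ((r ^+ d)%:E <= @lebesgue R d (box a (a + const_mx r)%R))%E.
Proof.
move=> r0; rewrite -[leLHS]mule1.
apply: (@le_trans _ _ ((r ^+ d)%:E * @lebesgue R d (box 0%R (const_mx 1%R)))%E).
  by rewrite lee_wpmul2l ?lee_fin ?exprn_ge0 ?lebesgue_unit_cube// ltW.
rewrite -(lebesgue_hom a)//; apply: le_lebesgue => _ [x x01 <-] i.
have := x01 i; rewrite !mxE => /andP[x0 x1].
by rewrite lerDr mulr_ge0 ?(ltW r0)//= addrC lerD2l ler_piMr// ltW.
Qed.

Lemma lebesgue_open_gt0 d (U : set 'rV[R]_d) : open U -> U !=set0 ->
  (0 < @lebesgue R d U)%E.
Proof.
move=> oU [x Ux]; have /nbhs_ballP[e /= e0 eU] := open_nbhs_nbhs (conj oU Ux).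
have e20 : 0 < e / 2 by rewrite divr_gt0.
rewrite (lt_le_trans _ (le_lebesgue (_ : box x (x + const_mx (e / 2))%R `<=` U)))//.
  by rewrite (lt_le_trans _ (lebesgue_cube _ e20))// lte_fin exprn_gt0.
move=> y xy; apply: eU; split => // i j; rewrite ord1 /ball /=.
have := xy j; rewrite !mxE ltr_norml => /andP[? ?]; apply/andP; split; lra.
Qed.

(** The multiples of [c] stay below the volume of the box. This is how a set is shown to be null,
    through infinitely many disjoint translates or dilates; [c] is extended real since it is built
    from a measure not yet known to be finite. *)
Lemma lebesgue_disjoint_bounded0 d (F : (set (borelRd R d))^nat) (a b : 'rV[R]_d)
    (c : \bar R) :
  (forall k, measurable (F k)) -> trivIset setT F ->
  (forall k, F k `<=` box a b) -> (0 <= c)%E -> (forall k, (c <= lebesgue (F k))%E) ->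
  c = 0%E.
Proof.
move=> mF tF Fab c0 cF.
pose M := \prod_(i < d) Num.max 0 (b ord0 i - a ord0 i).
have sumF : (\sum_(k <oo) lebesgue (F k) <= M%:E)%E.
  rewrite -lebesgue_bigcup//; last by move=> k; exact: lebesgue_caratheodory.
  apply: le_trans (le_lebesgue_box_setI setT a b); apply: le_lebesgue.
  by rewrite setTI; apply: bigcup_sub => k _; exact: Fab.
have M0 : 0 <= M by rewrite prodr_ge0// => i _; rewrite le_max lexx.
have sum_le n : (\sum_(0 <= k < n) lebesgue (F k) <= M%:E)%E.
  apply: le_trans sumF.
  by apply: nneseries_lim_ge => k _ _; exact: lebesgue_ge0.
case: c c0 cF => [r|_ cF|//]; last first.
  have := le_trans (cF 0%N) (le_trans _ (sum_le 1%N)).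
  by rewrite big_nat1 => /(_ (lexx _)); rewrite leye_eq.
rewrite lee_fin => r0 rF.
have rM n : r *+ n <= M.
  rewrite -lee_fin (le_trans _ (sum_le n))//.
  apply: (@le_trans _ _ (\sum_(0 <= k < n) r%:E)%E); last by apply: lee_sum => k _.
  by rewrite sumEFin sumr_const_nat subn0.
congr (_%:E); apply/eqP; rewrite eq_le r0 andbT leNgt; apply/negP => r_gt0.
have := rM (Num.bound (M / r)); apply/negP; rewrite -ltNge -mulr_natr.
rewrite mulrC -ltr_pdivrMr//.
by apply: archi_boundP; rewrite divr_ge0.
Qed.

End LebesgueMeasureTheory.

(** * Monotone relations *)

Section Dot.
Context {R : realType} {d : nat}.
Implicit Types x y z : 'rV[R]_d.

Lemma dotC x y : dot x y = dot y x.
Proof. by apply: eq_bigr => i _; rewrite mulrC. Qed.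

Lemma dotDr x y z : dot x (y + z) = dot x y + dot x z.
Proof. by rewrite /dot -big_split; apply: eq_bigr => i _; rewrite mxE mulrDr. Qed.

Lemma dotZr x (s : R) y : dot x (s *: y) = s * dot x y.
Proof. by rewrite /dot mulr_sumr; apply: eq_bigr => i _; rewrite mxE mulrCA. Qed.

Lemma dotNr x y : dot x (- y) = - dot x y.
Proof. by rewrite -scaleN1r dotZr mulN1r. Qed.

Lemma dotBr x y z : dot x (y - z) = dot x y - dot x z.
Proof. by rewrite dotDr dotNr. Qed.

Lemma dotDl x y z : dot (x + y) z = dot x z + dot y z.
Proof. by rewrite dotC dotDr !(dotC z). Qed.

Lemma dotZl (s : R) x y : dot (s *: x) y = s * dot x y.
Proof. by rewrite dotC dotZr dotC. Qed.

Lemma dotNl x y : dot (- x) y = - dot x y.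
Proof. by rewrite dotC dotNr dotC. Qed.

Lemma dotBl x y z : dot (x - y) z = dot x z - dot y z.
Proof. by rewrite dotDl dotNl. Qed.

Lemma dot0l x : dot 0 x = 0.
Proof. by rewrite -(scale0r (0 : 'rV[R]_d)) dotZl mul0r. Qed.

Lemma dot_subZ x y (s : R) : dot (x - s *: y) (x - s *: y) =
  dot x x - 2 * s * dot x y + s * s * dot y y.
Proof. rewrite dotBl !dotBr !dotZl !dotZr (dotC y x); ring. Qed.

Lemma dot_delta x i : dot x (delta_mx ord0 i) = x ord0 i.
Proof.
rewrite /dot (bigD1 i)//= big1 ?addr0 ?mxE ?eqxx ?mulr1// => j /negbTE ji.
by rewrite mxE ji andbF mulr0.
Qed.

Lemma dot_ge0 x : 0 <= dot x x.
Proof. by apply: sumr_ge0 => i _; rewrite -expr2 sqr_ge0. Qed.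

Lemma dot_eq0 x : dot x x = 0 -> x = 0.
Proof.
move/eqP; rewrite psumr_eq0 => [/allP x0|i _]; last by rewrite -expr2 sqr_ge0.
apply/rowP => i; have /implyP := x0 i (mem_index_enum i).
by rewrite mxE mulf_eq0 orbb => /(_ isT)/eqP.
Qed.

(** The norm is the maximum of the coordinates, which accounts for the factor [d] here and for the
    factors [d%:R + 1] later. *)
Lemma norm_dot_le x y : `|dot x y| <= d%:R * (`|x| * `|y|).
Proof.
rewrite (le_trans (ler_norm_sum _ _ _))//.
apply: (@le_trans _ _ (\sum_(i < d) `|x| * `|y|)).
  by apply: ler_sum => i _; rewrite normrM ler_pM// coord_le_norm.
by rewrite sumr_const card_ord mulr_natl.
Qed.

Lemma norm2_le_dot x : `|x| ^+ 2 <= dot x x.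
Proof.
rewrite -[leRHS]sqr_sqrtr ?dot_ge0// lerXn2r ?nnegrE ?sqrtr_ge0//.
apply: norm_le_coord => [|i]; first exact: sqrtr_ge0.
rewrite -[leLHS]sqrtr_sqr ler_sqrt ?dot_ge0// /dot (bigD1 i)//= expr2 lerDl.
by apply: sumr_ge0 => j _; rewrite -expr2 sqr_ge0.
Qed.

Lemma cvg_dot {T : Type} (F : set_system T) (FF : Filter F)
    (f g : T -> 'rV[R]_d) x y :
  f z @[z --> F] --> x -> g z @[z --> F] --> y ->
  dot (f z) (g z) @[z --> F] --> dot x y.
Proof.
move=> fx gy; apply: cvg_big => [|i _]; first exact: add_continuous.
apply: cvgM.
  apply: (@cvg_comp _ _ _ f (fun x : 'rV[R]_d => x ord0 i) _ _ _ fx).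
  exact: coord_continuous.
apply: (@cvg_comp _ _ _ g (fun x : 'rV[R]_d => x ord0 i) _ _ _ gy).
exact: coord_continuous.
Qed.

End Dot.

Section MonotoneRelation.
Context {R : realType} {d : nat}.
Variable F : 'rV[R]_d -> 'rV[R]_d -> Prop.

Definition image_rel (C : set 'rV[R]_d) := [set p | exists2 x, C x & F x p].

(** For the subgradient relation these are the p with an ambiguous slope; for its transpose, the
    slopes with several subgradients. *)
Definition multi_image := [set p | exists x y, [/\ x <> y, F x p & F y p]].

Hypothesis F_closed : closed [set xp : 'rV[R]_d * 'rV[R]_d | F xp.1 xp.2].

(** Tube argument: the complement of the graph is open around (x, p) for each x in [C], and
    compactness makes the neighborhood of p uniform in x. *)
Lemma closed_image_rel C : compact C -> closed (image_rel C).
Proof.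
move=> /compact_near_coveringP cC; rewrite -[X in closed X]setCK.
apply: open_closedC; rewrite openE => p np.
have : nbhs p [set q | C `<=` [set x | ~ F x q]].
  apply: (cC _ (nbhs p) (fun q x => ~ F x q)) => x Cx.
  have nFxp : (~` [set xp : 'rV[R]_d * 'rV[R]_d | F xp.1 xp.2]) (x, p).
    by move=> /= Fxp; apply: np; exists x.
  exact: (open_nbhs_nbhs (conj (closed_openC F_closed) nFxp)).
by apply: filterS => q Cq [x Cx]; exact: Cq.
Qed.

Hypothesis F_monotone : forall x p y q, F x p -> F y q ->
  0 <= dot (x - y) (p - q).

(** Two distinct x differ in a coordinate [i], two rationals separate them there, and a cube of
    integer size holds both and p. The two thresholds keep the half-spaces closed yet disjoint, so
    the pieces are closed and countably many. *)
Definition multi_piece (k : nat) : set 'rV[R]_d :=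
  if (unpickle k : option ('I_d * rat * rat * nat)) is Some (i, a, b, n) then
    let B := box (const_mx (- n%:R)) (const_mx n%:R) in
    if a < b then
      image_rel (B `&` [set x | x ord0 i <= ratr a]) `&`
      image_rel (B `&` [set x | ratr b <= x ord0 i]) `&` B
    else set0
  else set0.

Lemma compact_box (a b : 'rV[R]_d) : compact (box a b).
Proof.
by apply: (@rV_compact _ _ (fun i => `[a ord0 i, b ord0 i]%classic)) => i;
  exact: segment_compact.
Qed.

Lemma measurable_multi_piece k : measurable (multi_piece k : set (borelRd R d)).
Proof.
rewrite /multi_piece; case: unpickle => [[[[i a] b] n]|//].
case: ifPn => // _; apply: measurable_closed.
apply: closedI; last exact: closed_box.
apply: closedI; apply: closed_image_rel; apply: compact_closedI;
  [exact: compact_box|exact: closed_halfspace_le|exact: compact_box|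
   exact: closed_halfspace_ge].
Qed.

(* A line in the direction of the i-th axis meets the piece in at most one
   point, so small translates along that axis are disjoint. *)
Lemma lebesgue_multi_piece k : lebesgue (multi_piece k) = 0%E.
Proof.
have := measurable_multi_piece k; rewrite /multi_piece.
case: unpickle => [[[[i a] b] n]|_]; last by rewrite lebesgue_set0.
case: ifPn => [ab|_ _]; last by rewrite lebesgue_set0.
set B := box _ _; set P := _ `&` _ => mP.
pose e : 'rV[R]_d := delta_mx ord0 i.
(* Distinct shifts in (0, 1], so every translate fits in the cube enlarged by 1. *)
pose s (j : nat) : R := j.+1%:R^-1.
have s_inj : injective s by move=> j1 j2 /invr_inj/eqP; rewrite eqr_nat => /eqP[].
pose Fj j : set (borelRd R d) := (fun x => x + s j *: e) @` P.
(* Here p is above q along the axis, so monotonicity forces [y ord0 i <= x ord0 i], whereas x is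
   taken below [a] and y above [b]. *)
have sep p q u v : P p -> P q -> u < v -> p + u *: e = q + v *: e -> False.
  move=> [[[x [_ /= xa] Fxp] _] _] [[_ [y [_ /= yb] Fyq]] _] uv pq.
  have : 0 <= dot (x - y) (p - q) by exact: F_monotone.
  have -> : p - q = (v - u) *: e.
    rewrite scalerBl; apply/eqP; rewrite subr_eq addrAC.
    by rewrite [v *: e + q]addrC -pq addrK.
  rewrite dotZr dot_delta !mxE pmulr_rge0 ?subr_gt0// subr_ge0.
  move=> /(le_trans yb)/le_trans-/(_ _ xa); rewrite ler_rat leNgt ab.
  by [].
have tFj : trivIset setT Fj.
  apply/trivIsetP => j1 j2 _ _ j12; rewrite -subset0 => _ [[p Pp <-] [q Pq]].
  move=> qp; have [h|h|/s_inj h] := ltgtP (s j1) (s j2).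
  - exact: (sep p q _ _ Pp Pq h).
  - exact: (sep q p _ _ Pq Pp h).
  - by move: j12; rewrite h eqxx.
have FjE j : Fj j = (fun x => 1 *: x + s j *: e) @` P.
  by apply: eq_imagel => x _; rewrite scale1r.
apply: (@lebesgue_disjoint_bounded0 R d Fj (const_mx (- n%:R - 1))
  (const_mx (n%:R + 1))).
- by move=> j; rewrite FjE; exact: measurable_hom.
- exact: tFj.
- move=> j _ [x [_ xB] <-] l; have := xB l; rewrite !mxE => /andP[x1 x2].
  have s01 : 0 <= s j <= 1 by rewrite invr_ge0 ler0n invf_le1// ler1n.
  have : 0 <= s j *+ ((0 == 0 :> 'I_1) && (l == i)) <= 1.
    by rewrite eqxx; case: (l == i); rewrite ?mulr1n ?mulr0n ?lexx ?ler01.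
  rewrite -mulr_natr => /andP[? ?]; apply/andP; split; lra.
- exact: lebesgue_ge0.
- by move=> j; rewrite /Fj lebesgue_translation.
Qed.

Lemma multi_imageE : multi_image = \bigcup_k multi_piece k.
Proof.
apply/seteqP; split => [p [x [y [xy Fxp Fyp]]]|p [k _]]; last first.
  rewrite /multi_piece; case: unpickle => [[[[i a] b] n]|//].
  case: ifPn => // ab [[[x [_ /= xa] Fxp] [y [_ /= yb] Fyp]] _].
  exists x, y; split => // xy; move: xa; rewrite xy => /(le_trans yb).
  by rewrite ler_rat leNgt ab.
have key (x' y' : 'rV[R]_d) i : x' ord0 i < y' ord0 i -> F x' p -> F y' p ->
    (\bigcup_k multi_piece k) p.
  move=> xy' Fx Fy.
  have /rat_in_itvoo[b] := xy'; rewrite in_itv/= => /andP[xb bY].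
  have /rat_in_itvoo[a] := xb; rewrite in_itv/= => /andP[xa aB].
  have [n nP] : exists n : nat, `|x'| + `|y'| + `|p| < n%:R.
    by exists (Num.bound (`|x'| + `|y'| + `|p|)); apply: archi_boundP.
  have bd (z : 'rV[R]_d) : `|z| <= n%:R -> box (const_mx (- n%:R)) (const_mx n%:R) z.
    move=> zn l; rewrite !mxE -ler_norml (le_trans _ zn)//.
    exact: coord_le_norm.
  have := normr_ge0 x'; have := normr_ge0 y'; have := normr_ge0 p => p0 y0 x0.
  exists (pickle (i, a, b, n)); first exact: Logic.I.
  rewrite /multi_piece pickleK.
  rewrite -(ltr_rat R) aB; split; [split|].
  - exists x' => //; split; last exact: ltW.
    by apply: bd; lra.
  - exists y' => //; split; last exact: ltW.
    by apply: bd; lra.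
  - by apply: bd; lra.
have [i /eqP] : exists i, x ord0 i <> y ord0 i.
  apply/existsNP => xyE; apply: xy; apply/rowP; exact: xyE.
by rewrite neq_lt => /orP[xy'|xy']; exact: (key _ _ i xy').
Qed.

Lemma lebesgue_multi_image : lebesgue multi_image = 0%E.
Proof.
rewrite multi_imageE; apply: lebesgue_bigcup0; exact: lebesgue_multi_piece.
Qed.

Lemma measurable_multi_image : measurable (multi_image : set (borelRd R d)).
Proof.
rewrite multi_imageE; apply: (@bigcupT_measurable _ (borelRd R d)) => k.
exact: measurable_multi_piece.
Qed.

(** Off [multi_image] each p comes from at most one x, so taking images is taking inverse images
    under a partial function, whose domain takes the place of the whole space in a complement. *)
Lemma image_rel_modC E : image_rel (~` E) `\` multi_image =
  (image_rel setT `\` multi_image) `\` (image_rel E `\` multi_image).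
Proof.
apply/seteqP; split => [p [[x nEx Fx] np]|p [[[x _ Fx] np] npE]].
  split; first by split => //; exists x.
  move=> [[y Ey Fy] _]; apply: np; exists x, y; split => // xy.
  by apply: nEx; rewrite xy.
split => //; exists x => // Ex; apply: npE; split => //; by exists x.
Qed.

Lemma image_rel_mod_bigcup (E : (set 'rV[R]_d)^nat) :
  image_rel (\bigcup_k E k) `\` multi_image =
  \bigcup_k (image_rel (E k) `\` multi_image).
Proof.
apply/seteqP; split => [p [[x [k _ Ex] Fx] np]|p [k _ [[x Ex Fx] np]]].
  by exists k => //; split => //; exists x.
by split => //; exists x => //; exists k.
Qed.

Lemma image_rel_mod_disjoint E G : E `&` G = set0 ->
  (image_rel E `\` multi_image) `&` (image_rel G `\` multi_image) = set0.
Proof.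
move=> EG; rewrite -subset0 => p [[[x Ex Fx] np] [[y Gy Fy] _]].
apply: np; exists x, y; split => // xy; move: Ex; rewrite xy => Ey.
by have : (E `&` G) y by []; rewrite EG.
Qed.

(** Borel induction from closed sets: these are countable unions of compact sets, whose images are
    closed. *)
Lemma measurable_image_rel_mod (E : set (borelRd R d)) : measurable E ->
  measurable (image_rel E `\` multi_image : set (borelRd R d)).
Proof.
have mclosed (C : set 'rV[R]_d) : closed C ->
    measurable (image_rel C `\` multi_image : set (borelRd R d)).
  move=> cC; pose B (n : nat) : set 'rV[R]_d := box (const_mx (- n%:R)) (const_mx n%:R).
  rewrite (_ : C = \bigcup_n (C `&` B n)).
    rewrite image_rel_mod_bigcup.
    apply: (@bigcupT_measurable _ (borelRd R d)) => n; apply: measurableD.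
      apply: measurable_closed; apply: closed_image_rel; rewrite setIC.
      by apply: compact_closedI => //; exact: compact_box.
    exact: measurable_multi_image.
  apply/seteqP; split => [x Cx|x [n _ []]//].
  exists (Num.bound `|x|) => //; split => // i; rewrite !mxE -ler_norml.
  rewrite (le_trans (coord_le_norm _ _))// ltW//; exact: archi_boundP.
apply: (@smallest_sub _ (sigma_algebra setT) _ [set E : set (borelRd R d) |
    measurable (image_rel E `\` multi_image : set (borelRd R d))]).
  split => /=.
  - by apply: mclosed; exact: closed0.
  - move=> E' mE; rewrite setTD image_rel_modC; apply: measurableD => //.
    by apply: mclosed; exact: closedT.
  - move=> E' mE; rewrite image_rel_mod_bigcup.
    exact: (@bigcupT_measurable _ (borelRd R d)).
move=> U oU /=; rewrite -[U]setCK image_rel_modC; apply: measurableD.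
  by apply: mclosed; exact: closedT.
by apply: mclosed; exact: open_closedC.
Qed.

End MonotoneRelation.

(** * Convex open sets and differentiability *)

Section RowContinuity.
Context {R : realType} {d : nat} {T : topologicalType}.
Implicit Types (f g : T -> 'rV[R]_d) (s : T -> R).

Lemma continuous_rowD f g : continuous f -> continuous g ->
  continuous (fun z => f z + g z).
Proof. by move=> cf cg x; apply: (@cvgD _ _ _ (nbhs x)); [exact: cf|exact: cg]. Qed.

Lemma continuous_rowB f g : continuous f -> continuous g ->
  continuous (fun z => f z - g z).
Proof. by move=> cf cg x; apply: (@cvgB _ _ _ (nbhs x)); [exact: cf|exact: cg]. Qed.

Lemma continuous_rowZ s f : continuous s -> continuous f ->
  continuous (fun z => s z *: f z).
Proof. by move=> cs cf x; apply: (@cvgZ _ _ _ (nbhs x)); [exact: cs|exact: cf]. Qed.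

Lemma continuous_dot f g : continuous f -> continuous g ->
  continuous (fun z => dot (f z) (g z)).
Proof. by move=> cf cg x; apply: (@cvg_dot _ _ _ (nbhs x)); [exact: cf|exact: cg]. Qed.

End RowContinuity.

Section RowNeighbourhoods.
Context {R : realType} {d : nat}.
Implicit Types (x y : 'rV[R]_d) (U : set 'rV[R]_d).

Lemma nbhs_rowP x U :
  nbhs x U <-> exists2 e : R, 0 < e & forall y, `|y - x| < e -> U y.
Proof.
split => [/nbhs_ballP[e /= e0 eU]|[e e0 eU]].
  by exists e => // y yx; apply: eU; rewrite mx_norm_ball /ball_ /= distrC.
apply/nbhs_ballP; exists e => // y; rewrite mx_norm_ball /ball_ /= distrC.
exact: eU.
Qed.

Lemma nbhs_segment x (v : 'rV[R]_d) U : nbhs x U ->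
  exists2 e0 : R, 0 < e0 <= 1 & forall e, 0 <= e <= e0 -> U (x + e *: v).
Proof.
move=> /nbhs_rowP[r r0 rU].
have rv0 : 0 < r + `|v| by rewrite ltr_wpDr.
(* The denominator is positive even for [v = 0] and keeps the ratio at most 1. *)
exists (r / (r + `|v|)).
  by rewrite divr_gt0//= ler_pdivrMr// mul1r lerDl.
move=> e /andP[e0 er]; apply: rU; rewrite addrC addKr normrZ ger0_norm//.
rewrite (le_lt_trans (ler_wpM2r _ er))// mulrAC ltr_pdivrMr//.
by rewrite ltr_pM2l// ltrDr.
Qed.

End RowNeighbourhoods.

Section ConvexOpenSet.
Context {R : realType} {d : nat}.
Variable Omega : set 'rV[R]_d.
Hypotheses (Omega_open : open Omega) (Omega_convex : convex_set Omega).

Lemma i01_of (s : R) : 0 <= s <= 1 -> exists k : {i01 R}, k%:num = s.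
Proof. by move=> s01; exists (Itv01 (andP s01).1 (andP s01).2). Qed.

Lemma convex_setP (x y : 'rV[R]_d) (s : R) : Omega x -> Omega y -> 0 <= s <= 1 ->
  Omega ((1 - s) *: x + s *: y).
Proof.
move=> Ox Oy /i01_of[k <-]; rewrite addrC.
have := @Omega_convex y x k; rewrite !inE; exact.
Qed.

Lemma convex_open_closure (x y : 'rV[R]_d) (s : R) :
  closure Omega x -> Omega y -> 0 < s <= 1 ->
  Omega ((1 - s) *: x + s *: y).
Proof.
move=> cx Oy /andP[s0 s1].
(* [g z] solves [(1 - s) *: z + s *: g z = (1 - s) *: x + s *: y], and [g x = y]; so a point z of
   [Omega] close to x has its partner in [Omega] too. *)
pose g (z : 'rV[R]_d) : 'rV[R]_d := y + ((1 - s) / s) *: (x - z).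
have : nbhs x (g @^-1` Omega).
  have gx : continuous g.
    apply: continuous_rowD; first exact: cst_continuous.
    apply: continuous_rowZ; first exact: cst_continuous.
    by apply: continuous_rowB; [exact: cst_continuous|by move=> ?].
  apply: gx; apply: open_nbhs_nbhs; split => //.
  by rewrite /g subrr scaler0 addr0.
move=> /cx[z [Oz Ogz]].
have := @convex_setP z (g z) s Oz Ogz; rewrite (ltW s0) s1 => /(_ isT).
rewrite /g scalerDr scalerA mulrCA mulfV ?gt_eqF// mulr1 addrCA -scalerDr.
by rewrite [z + _]addrC subrK addrC.
Qed.

Lemma closure_convex (x y : 'rV[R]_d) (s : R) :
  closure Omega x -> closure Omega y -> 0 <= s <= 1 ->
  closure Omega ((1 - s) *: x + s *: y).
Proof.
move=> cx cy s01 U; set w := _ + _ => wU.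
have [c [Oc _]] := cx _ filterT.
(* Moving w slightly towards an interior point c amounts to moving both endpoints, which brings them
   into [Omega]. *)
have [e /andP[e0 e1] eU] := nbhs_segment (c - w) wU.
exists (w + e *: (c - w)); split; last by apply: eU; rewrite lexx ltW.
rewrite (_ : _ + _ = (1 - s) *: ((1 - e) *: x + e *: c) +
   s *: ((1 - e) *: y + e *: c)); last first.
  apply/rowP => i; rewrite /w !mxE; ring.
by apply: convex_setP => //; apply: convex_open_closure; rewrite // e0.
Qed.

Hypothesis Omega_bounded : bounded_set Omega.

Lemma closure_bounded : exists2 M : R, 0 < M &
  closure Omega `<=` [set x | `|x| <= M].
Proof.
have [M [_ OM]] := Omega_bounded.
exists (`|M| + 1); first by rewrite ltr_wpDl.
have cM : closed [set x : 'rV[R]_d | `|x| <= `|M| + 1].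
  apply: (@preimage_closed _ _ (fun x : 'rV[R]_d => `|x|)) (@closed_le R _).
  by move=> x _; exact: norm_continuous.
move=> x; rewrite closureE; apply; split => // z; apply: OM.
by rewrite (le_lt_trans (ler_norm _))// ltrDl.
Qed.

Lemma compact_closure : compact (closure Omega).
Proof.
apply: bounded_closed_compact; last exact: closed_closure.
have [M M0 cM] := closure_bounded.
exists M; split; first exact: num_real.
by move=> y My x /cM/le_trans; apply; exact: ltW.
Qed.

(* The dilates of the boundary about an interior point are pairwise disjoint. *)
Lemma lebesgue_boundary0 : lebesgue (closure Omega `\` Omega) = 0%E.
Proof.
have [[c Oc]|O0] := pselect (Omega !=set0); last first.
  rewrite (_ : Omega = set0) ?closure0 ?set0D ?lebesgue_set0//.
  by rewrite -subset0 => x Ox; apply: O0; exists x.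
(* Distinct ratios in [1/2, 1): at most 1 to stay in the bounding box, at least 1/2 to bound the
   measures of all dilates from below by one multiple of that of the boundary. *)
pose s (k : nat) : R := 1 - k.+2%:R^-1.
have s_gt k : 1 / 2 <= s k.
  have h : k.+2%:R^-1 <= (2:R)^-1 by rewrite lef_pV2 ?posrE ?ltr0n// ler_nat.
  by rewrite /s lerBrDr -lerBrDl (le_trans h)// mul1r; lra.
have s_lt k : s k < 1 by rewrite /s ltrBlDr ltrDl invr_gt0 ltr0n.
have s_inj : injective s.
  move=> j1 j2 /addrI/oppr_inj/invr_inj/eqP; rewrite eqr_nat => /eqP[].
  by [].
pose bd := closure Omega `\` Omega.
pose F k : set (borelRd R d) := (fun x => s k *: x + (1 - s k) *: c) @` bd.
have s_gt0 k : 0 < s k by apply: lt_le_trans (s_gt k); rewrite divr_gt0.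
(* If two dilates met, z would lie on the segment from y to c strictly past y, hence in [Omega] and
   not on the boundary. *)
have sep u v y z : 0 < u -> u < v -> v <= 1 -> bd y -> bd z ->
    u *: y + (1 - u) *: c = v *: z + (1 - v) *: c -> False.
  move=> u0 uv v1 [cy _] [_ nz] E; apply: nz.
  have v0 : 0 < v by exact: lt_trans uv.
  have -> : z = (1 - (1 - u / v)) *: y + (1 - u / v) *: c.
    apply: (@scalerI _ _ v); first by rewrite gt_eqF.
    have -> : v *: z = u *: y + (1 - u) *: c - (1 - v) *: c by rewrite E addrK.
    rewrite scalerDr !scalerA -addrA -scalerBl.
    by congr (_ *: _ + _ *: _); field; rewrite gt_eqF.
  apply: convex_open_closure => //.
  by rewrite subr_gt0 ltr_pdivrMr// mul1r uv gerBl divr_ge0// ltW.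
have tF : trivIset setT F.
  apply/trivIsetP => j1 j2 _ _ j12; rewrite -subset0 => _ [[p Pp <-] [q Pq]].
  move=> qp; have [h|h|/s_inj h] := ltgtP (s j1) (s j2).
  - by apply: (sep _ _ _ _ _ h _ Pp Pq) => //; exact: ltW.
  - by apply: (sep _ _ _ _ _ h _ Pq Pp) => //; exact: ltW.
  - by move: j12; rewrite h eqxx.
have [M M0 OM] := closure_bounded.
have c0 : (((1 / 2) ^+ d)%:E * lebesgue bd = 0)%E.
  apply: (@lebesgue_disjoint_bounded0 R d F (const_mx (- M)) (const_mx M)) => //.
  - move=> k; apply: measurable_hom => //.
    apply: measurableD; first by apply: measurable_closed; exact: closed_closure.
    exact: measurable_open.
  - move=> k _ [y [cy _] <-] i; rewrite !mxE -ler_norml.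
    have yM : `|y ord0 i| <= M by rewrite (le_trans (coord_le_norm _ _))// OM.
    have cM : `|c ord0 i| <= M.
      by rewrite (le_trans (coord_le_norm _ _))// OM//; exact: subset_closure.
    rewrite (le_trans (ler_normD _ _))// !normrM (gtr0_norm (s_gt0 k)).
    rewrite (gtr0_norm (_ : 0 < 1 - s k)) ?subr_gt0//.
    rewrite (_ : M = s k * M + (1 - s k) * M); last by ring.
    apply: lerD; apply: ler_wpM2l => //; first exact: ltW (s_gt0 k).
    by rewrite subr_ge0; exact: ltW (s_lt k).
  - by rewrite mule_ge0 ?lebesgue_ge0// lee_fin exprn_ge0// divr_ge0.
  - move=> k; rewrite lebesgue_hom// lee_wpmul2r ?lebesgue_ge0// lee_fin.
    by rewrite lerXn2r ?nnegrE ?divr_ge0// ltW.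
move/eqP: c0; rewrite mule_eq0 => /orP[|/eqP//].
by rewrite eqe expf_eq0 => /andP[_]; rewrite mul1r invr_eq0 pnatr_eq0.
Qed.

End ConvexOpenSet.

(** * Differentiability and affine minorants *)

Section Differentiability.
Context {R : realType} {d : nat}.
Implicit Types (x y p q v : 'rV[R]_d) (u : 'rV[R]_d -> R^o).

Lemma dot_linear x : linear (dot x : 'rV[R]_d -> R^o).
Proof. by move=> s y z; rewrite dotDr dotZr. Qed.

HB.instance Definition _ x := GRing.isLinear.Build R 'rV[R]_d R^o _
  (dot x : 'rV[R]_d -> R^o) (dot_linear x).

Lemma diff_of_remainder u p x :
  (forall e : R, 0 < e ->
     \forall q \near p, `|u q - u p - dot x (q - p)| <= e * `|q - p|) ->
  differentiable u p /\ forall v, 'D_v u p = dot x v.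
Proof.
move=> rem.
have cx : continuous (dot x : 'rV[R]_d -> R^o).
  by apply: continuous_dot; [exact: cst_continuous|move=> ?].
have E : u \o shift p = cst (u p) + (dot x : 'rV[R]_d -> R^o) +o_ (0 : 'rV[R]_d) id.
  apply/eqaddoP => e e0; apply/nbhs_rowP.
  have /nbhs_rowP[r r0 rP] := rem e e0.
  exists r => // h; rewrite subr0 => hr.
  have := rP (h + p); rewrite addrK => /(_ hr).
  by rewrite /= !fctE /= /shift /= opprD addrA.
have D : 'd u p = (dot x : 'rV[R]_d -> R^o) :> (_ -> _) by exact: diff_unique E.
have du : differentiable u p by apply/diff_locallyP; rewrite D; split.
by split => // v; rewrite deriveE// D.
Qed.

(** The supporting affine function bounds the differential from below in every direction; linearity
    and the direction [- v] turn this into equality. *)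
Lemma diff_supported u p x : differentiable u p ->
  (\forall q \near p, u p + dot x (q - p) <= u q) ->
  forall v, 'D_v u p = dot x v.
Proof.
move=> du sup.
have ge v : dot x v <= 'd u p v.
  rewrite leNgt; apply/negP => lt; pose w := dot x v - 'd u p v.
  have w0 : 0 < w by rewrite subr_gt0.
  pose e := w / (2 * (`|v| + 1)).
  have e0 : 0 < e by rewrite divr_gt0// mulr_gt0// ltr_wpDl.
  have [_ /eqaddoP/(_ e e0)] := (diff_locallyP _ _).1 du => rem.
  have rem' : nbhs (0 : 'rV[R]_d) [set h | `|u (h + p) - (u p + 'd u p h)| <= e * `|h|].
    exact: rem.
  have sup' : nbhs (0 : 'rV[R]_d) [set h | u p + dot x h <= u (h + p)].
    have /nbhs_rowP[r r0 rP] := sup; apply/nbhs_rowP; exists r => // h.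
    by rewrite subr0 => hr; have := rP (h + p); rewrite addrK; exact.
  have [s /andP[s0 s1] sP] := nbhs_segment v (filterI rem' sup').
  have [|/= h1 h2] := sP s; first by rewrite lexx ltW.
  move: h1 h2; rewrite add0r dotZr linearZ normrZ gtr0_norm// ler_norml => /andP[_].
  rewrite /= -[_ *: 'd u p v]/(s * 'd u p v) => h1 h2.
  have h3 : s * w <= s * (e * `|v|) by rewrite /w; lra.
  move: h3; rewrite ler_pM2l// /e leNgt => /negP; apply.
  rewrite mulrAC ltr_pdivrMr ?mulr_gt0 ?ltr_wpDl// ltr_pM2l//.
  by have := normr_ge0 v; lra.
move=> v; rewrite deriveE//; apply/eqP; rewrite eq_le ge andbT.
by rewrite -lerN2 -!linearN; exact: ge.
Qed.

End Differentiability.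

(** * Strong convexity along almost every line *)

Section StrongConvexity.
Context {R : realType}.

(* Bisection: if the quadratic gain holds with constant [k] on every
   subinterval, then it holds with constant [(1 + 2 k) / 4], whose fixed point
   is 1/2. *)
Lemma strongly_convex_segment (G X : R -> R) (c : R) : 0 <= c ->
  (forall s u, 0 <= s <= 1 -> 0 <= u <= 1 -> G s + X s * (u - s) <= G u) ->
  (forall s u, 0 <= s <= 1 -> 0 <= u <= 1 ->
     c * (u - s) ^+ 2 <= (X u - X s) * (u - s)) ->
  forall s u, 0 <= s <= 1 -> 0 <= u <= 1 ->
    G s + X s * (u - s) + c / 2 * (u - s) ^+ 2 <= G u.
Proof.
move=> c0 GX Xc.
have step n : forall s u, 0 <= s <= 1 -> 0 <= u <= 1 ->
    G s + X s * (u - s) + c * (2^-1 - 2^-1 ^+ n.+1) * (u - s) ^+ 2 <= G u.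
  elim: n => [|n IH] s u s01 u01.
    by rewrite expr1 subrr mulr0 mul0r addr0 GX.
  pose w := (s + u) / 2.
  have w01 : 0 <= w <= 1.
    by move: s01 u01 => /andP[? ?] /andP[? ?]; apply/andP; split; rewrite /w; lra.
  have h1 := IH s w s01 w01; have h2 := IH w u w01 u01.
  have h3 := Xc s w s01 w01.
  rewrite exprS; move: h1 h2; set k := 2^-1 ^+ n.+1.
  have -> : w - s = (u - s) / 2 by rewrite /w; field.
  have -> : u - w = (u - s) / 2 by rewrite /w; field.
  have h4 : c * ((u - s) / 2) ^+ 2 <= (X w - X s) * ((u - s) / 2).
    by move: h3; rewrite (_ : w - s = (u - s) / 2)//; rewrite /w; field.
  rewrite !expr_div_n; move: h4; rewrite !expr_div_n; lra.
move=> s u s01 u01; apply/ler_addgt0Pr => e e0.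
pose D := c * (u - s) ^+ 2.
have D0 : 0 <= D by rewrite mulr_ge0// sqr_ge0.
have [n nP] : exists n : nat, 2^-1 ^+ n.+1 * D <= e.
  have [n] : exists n : nat, D / e < n%:R.
    by exists (Num.bound (D / e)); apply: archi_boundP; rewrite divr_ge0// ltW.
  rewrite ltr_pdivrMr// => nP; exists n.
  rewrite exprVn ler_pdivrMl ?exprn_gt0//.
  rewrite (le_trans (ltW nP))// ler_wpM2r ?(ltW e0)//.
  by rewrite -natrX ler_nat (leq_trans (ltnW (ltnSn n)))// ltnW// ltn_expl.
have := step n s u s01 u01; move: nP; rewrite /D; lra.
Qed.

Section SlopeGap.
Variables (X : R -> R) (c : R).
Hypotheses (c_gt0 : 0 < c)
  (X_nd : forall s u, 0 <= s -> s <= u -> u <= 1 -> X s <= X u).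

Definition affine_slope (s : R) := exists v, \forall s' \near s, X s' = c * s' + v.

Hypothesis affine_ae : lebesgue
  [set v : 'rV[R]_1 | 0 < v ord0 ord0 < 1 /\ ~ affine_slope (v ord0 ord0)] = 0%E.

(* On the affine set, [X] is injective and locally a homothety of ratio [c],
   so its image, contained in [X s, X u], has measure [c * (u - s)]. *)
Lemma slope_gap s u : 0 <= s -> s < u -> u <= 1 -> c * (u - s) <= X u - X s.
Proof.
move=> s0 su u1.
pose O : set R := [set r | s < r < u /\ affine_slope r].
have oO : open O.
  rewrite openE => r [/andP[sr ru] [v rv]].
  have h1 : \forall r' \near r, s < r' by exact: lt_nbhsr.
  have h2 : \forall r' \near r, r' < u by exact: lt_nbhsl.
  have h3 : \forall r' \near r, affine_slope r'.
    by apply: filterS (near_join rv) => r' r'v; exists v.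
  by apply: filterS3 h1 h2 h3 => r' sr' r'u ar'; split => //; rewrite sr'.
pose U : set 'rV[R]_1 := [set v | O (v ord0 ord0)].
have c0 : continuous (fun v : 'rV[R]_1 => v ord0 ord0) by exact: coord_continuous.
have oU : open U by apply: open_comp => // v _; exact: c0.
pose T (v : 'rV[R]_1) : 'rV[R]_1 := const_mx (X (v ord0 ord0)).
have rowE (v : 'rV[R]_1) : v = const_mx (v ord0 ord0).
  by apply/rowP => i; rewrite mxE ord1.
have O01 r : O r -> 0 <= r /\ r <= 1.
  by move=> [/andP[? ?] _]; split; lra.
(* Monotonicity alone gives a weak inequality; strictness comes from the piece of slope [c] just to
   the right of r, up to [m]. *)
have X_inj r r' : O r -> O r' -> r < r' -> X r < X r'.
  move=> Or Or' rr'; have [_ [v /nbhs_ballP[e /= e0 rv]]] := Or.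
  pose m := Num.min (r + e / 2) r'.
  have rm : r < m by rewrite lt_min rr' andbT; lra.
  have mr' : m <= r' by rewrite ge_min lexx orbT.
  have me : m <= r + e / 2 by rewrite ge_min lexx.
  have Xm : X m = c * m + v.
    apply: rv; rewrite /ball /= distrC ger0_norm; lra.
  have Xr : X r = c * r + v by apply: rv; exact: ballxx.
  have [r0 _] := O01 _ Or; have [_ r1] := O01 _ Or'.
  apply: (@lt_le_trans _ _ (X m)); last by apply: X_nd => //; lra.
  by rewrite Xm Xr ltrD2r ltr_pM2l.
have injT : {in U &, injective T}.
  move=> v v'; rewrite !inE => Uv Uv' /rowP/(_ ord0); rewrite !mxE => XX.
  rewrite (rowE v) (rowE v'); congr const_mx.
  have [h|h|//] := ltgtP (v ord0 ord0) (v' ord0 ord0).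
    by have := X_inj _ _ Uv Uv' h; rewrite XX ltxx.
  by have := X_inj _ _ Uv' Uv h; rewrite XX ltxx.
have homT v : U v -> exists w, \forall y \near v, T y = c *: y + w.
  move=> [_ [w vw]]; exists (const_mx w).
  have vw' : nbhs v [set y : 'rV[R]_1 | X (y ord0 ord0) = c * y ord0 ord0 + w].
    exact: (c0 v _ vw).
  apply: filterS vw' => y yw; apply/rowP => i.
  by rewrite !mxE (ord1 i) [LHS]yw.
have image_le : (lebesgue (T @` U) <= (X u - X s)%:E)%E.
  apply: (@le_trans _ _
    (lebesgue (box (const_mx (X s)) (const_mx (X u)) : set 'rV[R]_1))).
    apply: le_lebesgue => _ [v Uv <-] i; rewrite !mxE.
    have [h0 h1] := O01 _ Uv; have [/andP[? ?] _] := Uv.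
    by apply/andP; split; apply: X_nd => //; lra.
  apply: le_trans (lebesgue_box_le _) _.
    by move=> i; rewrite !mxE X_nd//; lra.
  by rewrite big_ord1 !mxE.
have point0 r : lebesgue (box (const_mx r) (const_mx r) : set 'rV[R]_1) = 0%E.
  apply/eqP; rewrite eq_le lebesgue_ge0 andbT.
  by apply: le_trans (lebesgue_box_le _) _ => //; rewrite big_ord1 subrr.
have lenU : ((u - s)%:E <= lebesgue U)%E.
  have us : 0 < u - s by rewrite subr_gt0.
  have := lebesgue_cube (const_mx s : 'rV[R]_1) us; rewrite expr1 => /le_trans; apply.
  (* Besides the non-affine points, only the two endpoints are missing from [U]; they are null as
     degenerate boxes. *)
  pose N := [set v : 'rV[R]_1 | 0 < v ord0 ord0 < 1 /\ ~ affine_slope (v ord0 ord0)] `|`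
    (box (const_mx s) (const_mx s) `|` box (const_mx u) (const_mx u)).
  have N0 : lebesgue N = 0%E.
    by apply: lebesgue_setU0 => //; exact: lebesgue_setU0.
  apply: (@le_trans _ _ (lebesgue (U `|` N))).
    apply: le_lebesgue => v /(_ ord0); rewrite !mxE addrC subrK => /andP[sv vu].
    have [vs|vs] := eqVneq (v ord0 ord0) s.
      by right; right; left; rewrite (rowE v) vs => i; rewrite !mxE lexx.
    have [vU|vU] := eqVneq (v ord0 ord0) u.
      by right; right; right; rewrite (rowE v) vU => i; rewrite !mxE lexx.
    have sv' : s < v ord0 ord0 by rewrite lt_neqAle eq_sym vs.
    have vu' : v ord0 ord0 < u by rewrite lt_neqAle vU.
    have [av|av] := pselect (affine_slope (v ord0 ord0)).
      by left; split => //; rewrite sv'.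
    by right; left; split => //; apply/andP; split; lra.
  by rewrite (le_trans (lebesgueU_le _ _))// N0 adde0.
rewrite -lee_fin (le_trans _ image_le)//.
rewrite (lebesgue_piecewise_hom c_gt0 oU injT homT (@subset_refl _ U)) expr1 EFinM.
by rewrite lee_wpmul2l// lee_fin ltW.
Qed.

End SlopeGap.
End StrongConvexity.

(** * Null sets on parallel lines, by Fubini's theorem *)

Section NullLines.
Context {R : realType} {d : nat}.
Local Open Scope ereal_scope.

(** Links the product topology to the product of the Borel structures: an open set is a countable
    union of rational rectangles. *)
Lemma measurable_open_prod {m n} (U : set ('rV[R]_m * 'rV[R]_n)) : open U ->
  measurable (U : set (borelRd R m * borelRd R n)%type).
Proof.
move=> oU.
have mrb j k : measurable (@rational_box R j k : set (borelRd R j)).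
  by rewrite /rational_box; case: unpickle => [ab|//]; exact: measurable_box.
pose V i j := if `[< @rational_box R m i `*` @rational_box R n j `<=` U >]
  then @rational_box R m i `*` @rational_box R n j else set0.
rewrite (_ : U = \bigcup_i \bigcup_j V i j).
  apply: (@bigcupT_measurable _ (borelRd R m * borelRd R n)%type) => i.
  apply: (@bigcupT_measurable _ (borelRd R m * borelRd R n)%type) => j.
  rewrite /V; case: asboolP => // _; exact: measurableX.
apply/seteqP; split => [[x y] Uxy|[x y] [i _ [j _]]]; last first.
  by rewrite /V; case: asboolP => // h; exact: h.
have [[A B] /= [xA yB] AB] : nbhs (x, y) U by exact: open_nbhs_nbhs.
have [i [xi iA]] := rational_box_nbhs xA; have [j [yj jB]] := rational_box_nbhs yB.
exists i => //; exists j => //; rewrite /V asboolT.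
  by split; exact: nbhs_singleton.
by move=> [x' y'] [/= x'i y'j]; apply: AB; split => /=; [exact: iA|exact: jB].
Qed.

Lemma measurable_preimage_prod {m n k} (f : 'rV[R]_m * 'rV[R]_n -> 'rV[R]_k)
    (E : set (borelRd R k)) : continuous f -> measurable E ->
  measurable (f @^-1` E : set (borelRd R m * borelRd R n)%type).
Proof.
move=> cf; apply: (@smallest_sub _ (sigma_algebra setT) _
    [set E : set (borelRd R k) |
      measurable (f @^-1` E : set (borelRd R m * borelRd R n)%type)]).
  split => /=.
  - by rewrite preimage_set0.
  - by move=> A mA; rewrite setTD preimage_setC; exact: measurableC.
  - move=> F mF; rewrite preimage_bigcup.
    exact: (@bigcupT_measurable _ (borelRd R m * borelRd R n)%type).
by move=> U oU; apply: measurable_open_prod; apply: open_comp => // x _; exact: cf.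
Qed.

(** For fixed v the w that reach [N] form a translate of [N], so the incidence set is null in the
    product. In the other order of integration almost every w has a null line, and [W] is too large
    to avoid all of these. *)
Lemma exists_null_line (N W : set (borelRd R d)) (p e : 'rV[R]_d) :
  measurable N -> lebesgue N = 0 -> 0 < lebesgue W ->
  exists2 w, W w &
    lebesgue [set v : 'rV[R]_1 | N (p + w + v ord0 ord0 *: e)%R] = 0.
Proof.
move=> mN N0 W0.
pose f (vw : 'rV[R]_1 * 'rV[R]_d) : 'rV[R]_d := (p + vw.2 + vw.1 ord0 ord0 *: e)%R.
have cf : continuous f.
  apply: continuous_rowD.
    apply: continuous_rowD; first exact: cst_continuous.
    by move=> ?; exact: cvg_snd.
  apply: continuous_rowZ; last exact: cst_continuous.
  move=> vw; apply: (@cvg_comp _ _ _ fst (fun v : 'rV[R]_1 => v ord0 ord0)).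
    exact: cvg_fst.
  exact: coord_continuous.
pose Z : set (borelRd R 1 * borelRd R d)%type := f @^-1` N.
have mZ : measurable Z by exact: measurable_preimage_prod.
pose l1 := @lebesgue R 1; pose l2 := @lebesgue R d.
have Z1 : (l1 \x l2) Z = 0.
  rewrite /product_measure1 integral0_eq// => v _ /=.
  rewrite /xsection /Z.
  apply: (@lebesgue_sub0 _ _ _
    ((fun x => x + - (p + v ord0 ord0 *: e))%R @` N)); last first.
    by rewrite lebesgue_translation.
  move=> w /=; rewrite inE /f /= => Nw.
  eexists; first exact: Nw.
  by apply/rowP => i; rewrite !mxE; ring.
have Z2 : (l1 \x^ l2) Z = 0.
  rewrite -Z1; apply/esym; apply: (product_measure_unique (m1 := lebesgue)
    (m2 := lebesgue) (m' := (lebesgue \x^ lebesgue))) => // A B mA mB.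
  exact: product_measure2E.
have mf : measurable_fun setT (l1 \o ysection Z) by exact: measurable_fun_ysection.
have /(ae_eq_integral_abs l2 measurableT mf).1 [B [mB B0 nB]] :
    \int[l2]_(w in setT) `|(l1 \o ysection Z) w| = 0.
  rewrite -[RHS]Z2 /product_measure2; apply: eq_integral => w _.
  by rewrite gee0_abs//; exact: lebesgue_ge0.
have [w [Ww nBw]] : exists w, W w /\ ~ B w.
  apply: contrapT => h; move: W0; rewrite (_ : lebesgue W = 0) ?ltxx//.
  apply: (lebesgue_sub0 _ B0) => w Ww; apply: contrapT => nBw.
  by apply: h; exists w.
exists w => //; apply: contrapT => nw; apply: nBw; apply: nB => /= h; apply: nw.
have := h Logic.I; rewrite /= => <-; congr (lebesgue _).
by apply/seteqP; split => v; rewrite /ysection /= inE.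
Qed.
End NullLines.

(** * The Legendre transform of the potential *)

Section Compactness.
Context {R : realType} {d : nat}.

Lemma image_rel_avoid (F : 'rV[R]_d -> 'rV[R]_d -> Prop) C p :
  closed [set xp : 'rV[R]_d * 'rV[R]_d | F xp.1 xp.2] -> compact C ->
  (forall x, C x -> ~ F x p) -> \forall q \near p, forall x, C x -> ~ F x q.
Proof.
move=> cF cC np; have := closed_openC (closed_image_rel cF cC) => oC.
have pC : (~` image_rel F C) p by move=> [x Cx Fx]; exact: np Cx Fx.
apply: filterS (open_nbhs_nbhs (conj oC pC)) => q nq x Cx Fxq.
by apply: nq; exists x.
Qed.

Lemma compact_annulus (x : 'rV[R]_d) (C : set 'rV[R]_d) (e : R) : compact C ->
  compact (C `&` [set y | e <= `|y - x|]).
Proof.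
move=> cC; apply: compact_closedI => //.
apply: (@preimage_closed _ _ (fun y : 'rV[R]_d => `|y - x|)) (@closed_ge R _).
have cB : continuous (fun y : 'rV[R]_d => y - x).
  by apply: continuous_rowB; [move=> ?|exact: cst_continuous].
by move=> y _; exact: (@cvg_norm _ _ _ (nbhs y) _ _ _ (cB y)).
Qed.

Lemma closed_transpose (F : 'rV[R]_d -> 'rV[R]_d -> Prop) :
  closed [set xp : 'rV[R]_d * 'rV[R]_d | F xp.1 xp.2] ->
  closed [set xp : 'rV[R]_d * 'rV[R]_d | F xp.2 xp.1].
Proof.
apply: (@preimage_closed _ _ (fun xp : 'rV[R]_d * 'rV[R]_d => (xp.2, xp.1))).
by move=> xp _; exact: swap_continuous.
Qed.

End Compactness.

Section Potential.
Context {R : realType} {d : nat}.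
Variables (Omega : set 'rV[R]_d) (phi : 'rV[R]_d -> R) (t : R).
Hypotheses (Omega_open : open Omega) (Omega_bounded : bounded_set Omega)
  (Omega_convex : convex_set Omega)
  (phi_continuous : {within closure Omega, continuous phi})
  (Omega_neq0 : Omega !=set0) (t_gt0 : 0 < t).
Implicit Types x y z p q : 'rV[R]_d.

Local Notation K := (closure Omega).
Local Notation psi_t := (psi Omega phi t).

Definition psi_real z : R := 2^-1 * dot z z + t * phi z.

Local Notation psr := psi_real.

Lemma psiE z : K z -> psi_t z = (psr z)%:E.
Proof. by move=> Kz; rewrite /psi asboolT. Qed.

Lemma psi_out z : ~ K z -> psi_t z = +oo%E.
Proof. by move=> Kz; rewrite /psi asboolF. Qed.

Lemma psi_real_continuous : {within K, continuous psr}.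
Proof.
move=> z; apply: cvgD; last first.
  by apply: cvgM; [exact: cvg_cst|exact: phi_continuous].
apply: cvgM; first exact: cvg_cst.
have : {within K, continuous (fun z => dot z z)}.
  apply: continuous_subspaceT.
  by apply: continuous_dot; move=> ?.
exact.
Qed.

Lemma K_neq0 : K !=set0.
Proof. by have [z Oz] := Omega_neq0; exists z; exact: subset_closure. Qed.

Lemma legendre_psi_attained x : exists z, [/\ K z,
  legendre psi_t x = (dot x z - psr z)%:E &
  forall y, K y -> dot x y - psr y <= dot x z - psr z].
Proof.
have cont : {within K, continuous (fun z => dot x z - psr z)}.
  move=> z; apply: cvgB; last exact: psi_real_continuous.
  have : {within K, continuous (fun z => dot x z)}.
    apply: continuous_subspaceT.
    by apply: continuous_dot; [exact: cst_continuous|move=> ?].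
  exact.
have [z Kz zmax] := EVT_max_rV K_neq0 (compact_closure Omega_bounded) cont.
move: Kz; rewrite inE => Kz.
have {}zmax y : K y -> dot x y - psr y <= dot x z - psr z.
  by move=> Ky; apply: zmax; rewrite inE.
exists z; split => //; apply/eqP; rewrite eq_le; apply/andP; split.
  apply: ge_ereal_sup => _ [y _ <-].
  have [Ky|Ky] := pselect (K y); first by rewrite psiE// -EFinB lee_fin zmax.
  by rewrite psi_out//= leNye.
by apply: ereal_sup_ubound; exists z => //; rewrite psiE.
Qed.

Definition psi_star x : R := fine (legendre psi_t x).

Lemma legendre_psiE x : legendre psi_t x = (psi_star x)%:E.
Proof. by have [z [_ E _]] := legendre_psi_attained x; rewrite /psi_star E. Qed.

Lemma psi_star_attained x : exists2 z, K z & psi_star x = dot x z - psr z.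
Proof.
by have [z [Kz E _]] := legendre_psi_attained x; exists z; rewrite // /psi_star E.
Qed.

Lemma psi_star_ge x z : K z -> dot x z - psr z <= psi_star x.
Proof.
by move=> Kz; have [y [_ E m]] := legendre_psi_attained x; rewrite /psi_star E m.
Qed.

Lemma psi_star_lipschitz : exists2 C, 0 < C &
  forall x y, psi_star x <= psi_star y + C * `|x - y|.
Proof.
have [M M0 KM] := closure_bounded Omega_bounded.
(* The points of [K] are the slopes of the affine functions under the supremum, so their bound
   controls the increments; the 1 keeps the constant positive for [d = 0]. *)
exists (d%:R * M + 1) => [|x y]; first by rewrite ltr_wpDl// mulr_ge0// ltW.
have [z Kz ->] := psi_star_attained x; have := psi_star_ge y Kz.
have : dot (x - y) z <= (d%:R * M + 1) * `|x - y|.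
  rewrite (le_trans (ler_norm _))// (le_trans (norm_dot_le _ _))//.
  rewrite mulrDl mul1r mulrCA mulrC ler_wpDr// ler_wpM2r// ler_wpM2l//.
  exact: KM.
rewrite dotBl; lra.
Qed.

Lemma psi_star_continuous : continuous psi_star.
Proof.
have [C C0 fC] := psi_star_lipschitz; move=> x.
apply/(@cvgrPdist_le _ _ _ (nbhs x)) => e e0; apply/nbhs_rowP.
exists (e / C) => [|y yx]; first exact: divr_gt0.
have {}yx : C * `|y - x| <= e by rewrite mulrC -ler_pdivlMr// ltW.
rewrite /= ler_norml; have := fC x y; have := fC y x; rewrite (distrC x).
by move=> ? ?; apply/andP; split; lra.
Qed.

Definition subgrad x p := forall z, psi_star x + dot p (z - x) <= psi_star z.

Lemma subdifferentialE x : subdifferential (legendre psi_t) x = [set p | subgrad x p].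
Proof.
apply/seteqP; split => p /= Fp z; have := Fp z; last first.
  by rewrite !legendre_psiE -EFinD lee_fin.
by rewrite !legendre_psiE -EFinD lee_fin.
Qed.

Lemma subgrad_closed : closed [set xp : 'rV[R]_d * 'rV[R]_d | subgrad xp.1 xp.2].
Proof.
rewrite (_ : mkset _ = \bigcap_z [set xp : 'rV[R]_d * 'rV[R]_d |
    psi_star xp.1 + dot xp.2 (z - xp.1) <= psi_star z]); last first.
  by apply/seteqP; split => [xp h z _|xp h z]; [exact: h|exact: h].
apply: closed_bigI => z _.
apply: (@preimage_closed _ _ (fun xp : 'rV[R]_d * 'rV[R]_d =>
    psi_star xp.1 + dot xp.2 (z - xp.1))) (@closed_le R _).
move=> xp _; apply: cvgD.
  apply: continuous_comp; [exact: cvg_fst|exact: psi_star_continuous].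
have : continuous (fun xp : 'rV[R]_d * 'rV[R]_d => dot xp.2 (z - xp.1)).
  apply: continuous_dot; first by move=> ?; exact: cvg_snd.
  apply: continuous_rowB; first exact: cst_continuous.
  by move=> ?; exact: cvg_fst.
exact.
Qed.

Lemma subgrad_monotone x p y q : subgrad x p -> subgrad y q ->
  0 <= dot (x - y) (p - q).
Proof.
move=> /(_ y) + /(_ x); rewrite !(dotBl, dotBr) (dotC p) (dotC p) (dotC q) (dotC q).
lra.
Qed.

Lemma nearest_point p : exists2 q, K q & forall z, K z -> dot (p - q) (z - q) <= 0.
Proof.
have cont : {within K, continuous (fun z => dot (p - z) (p - z))}.
  apply: continuous_subspaceT.
  have cB : continuous (fun z => p - z).
    by apply: continuous_rowB; [exact: cst_continuous|move=> ?].
  exact: continuous_dot.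
have [q Kq qmin] := EVT_min_rV K_neq0 (compact_closure Omega_bounded) cont.
move: Kq; rewrite inE => Kq; exists q => // z Kz.
rewrite leNgt; apply/negP => pos.
set u := p - q in pos; set v := z - q in pos.
have v0 : 0 <= dot v v by exact: dot_ge0.
have key s : 0 <= s <= 1 -> 2 * s * dot u v <= s * s * dot v v.
  move=> s01; have := qmin ((1 - s) *: q + s *: z).
  rewrite inE => /(_ (closure_convex Omega_open Omega_convex Kq Kz s01)).
  have -> : p - ((1 - s) *: q + s *: z) = u - s *: v.
    by apply/rowP => i; rewrite /u /v !mxE; ring.
  rewrite -/u dot_subZ; lra.
(* This choice is at most 1 and gives [s * dot v v < dot u v], against [2 * dot u v <= s * dot v v]
   from minimality. *)
pose s := dot u v / (dot u v + dot v v).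
have den : 0 < dot u v + dot v v by rewrite ltr_wpDr.
have s_gt : 0 < s by rewrite divr_gt0.
have s01 : 0 <= s <= 1 by rewrite ltW//= ler_pdivrMr// mul1r lerDl.
have := key s s01; rewrite -mulrA mulrCA -mulrA ler_pM2l//.
rewrite leNgt => /negP; apply.
have : s * dot v v < dot u v.
  rewrite /s mulrAC ltr_pdivrMr// ltr_pM2l//; lra.
lra.
Qed.

(** In the direction [u] from the nearest point q of [K] to p, [psi_star] rises by at most
    [dot u q], as a supremum of affine functions with slopes in [K], and by at least [dot u p];
    hence [u = 0]. *)
Lemma subgrad_closure x p : subgrad x p -> K p.
Proof.
move=> Fxp; have [q Kq qP] := nearest_point p.
set u := p - q in qP.
have [z Kz fz] := psi_star_attained (x + u).
have uu : dot u u = dot u p - dot u q by rewrite {2}/u dotBr.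
have := Fxp (x + u); rewrite fz [x + u]addrC addrK dotDl (dotC p) => h.
have := psi_star_ge x Kz; have := qP z Kz; rewrite dotBr => h1 h2.
have /dot_eq0/eqP : dot u u = 0 by have := dot_ge0 u; lra.
by rewrite subr_eq0 => /eqP ->.
Qed.

Lemma psi_real_bounded : exists C, forall z, K z -> psr z <= C.
Proof.
have [z _ zm] := EVT_max_rV K_neq0 (compact_closure Omega_bounded) psi_real_continuous.
by exists (psr z) => y Ky; apply: zm; rewrite inE.
Qed.

(* Evaluating the supremum at [q + r x / |x|]. *)
Lemma psi_star_coercive p : Omega p -> exists2 r, 0 < r & exists C,
  forall x q, `|q - p| < r -> r * `|x| + dot x q - C <= psi_star x.
Proof.
move=> Op; have [e e0 eO] := (nbhs_rowP _ _).1 (open_nbhs_nbhs (conj Omega_open Op)).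
have [C KC] := psi_real_bounded.
have e20 : 0 < e / 2 by rewrite divr_gt0.
exists (e / 2) => //; exists C => x q qp.
pose z := q + (e / 2 / `|x|) *: x.
have normz : `|z - q| <= e / 2.
  rewrite /z addrC addKr normrZ ger0_norm; last by rewrite !divr_ge0// ltW.
  have [->|x0] := eqVneq x 0; first by rewrite normr0 mulr0 ltW.
  by rewrite divfK ?normr_eq0.
have Kz : K z.
  apply: subset_closure; apply: eO.
  have -> : z - p = (z - q) + (q - p) by rewrite addrA subrK.
  rewrite (le_lt_trans (ler_normD _ _))//; lra.
have dz : e / 2 * `|x| <= dot x (z - q).
  rewrite /z [q + _]addrC addrK dotZr.
  have [->|x0] := eqVneq x 0; first by rewrite normr0 dot0l !mulr0.
  rewrite -[leRHS]mulrA ler_pM2l// ler_pdivlMl ?normr_gt0// -expr2.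
  exact: norm2_le_dot.
have := psi_star_ge x Kz; have := KC z Kz; move: dz; rewrite dotBr; lra.
Qed.

Lemma subgrad_iff x p :
  subgrad x p <-> forall z, dot p z - psi_star z <= dot p x - psi_star x.
Proof. by split => h z; have := h z; rewrite dotBr; lra. Qed.

Lemma exists_subgrad p : Omega p -> exists x, subgrad x p.
Proof.
move=> Op; have [r r0 [C fC]] := psi_star_coercive Op.
(* Radius beyond which coercivity puts [dot p z - psi_star z] below its value at 0. *)
pose N := `|C + psi_star 0| / r.
have N0 : 0 <= N by rewrite divr_ge0// ltW.
pose B : set 'rV[R]_d := box (const_mx (- N)) (const_mx N).
have cont : {within B, continuous (fun x => dot p x - psi_star x)}.
  have cd : continuous (fun x => dot p x).
    by apply: continuous_dot; [exact: cst_continuous|move=> ?].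
  apply: continuous_subspaceT => x.
  by apply: (@cvgB _ _ _ (nbhs x)); [exact: cd|exact: psi_star_continuous].
have B0 : B 0 by move=> i; rewrite !mxE oppr_le0 N0.
have [||x Bx xmax] := EVT_max_rV _ _ cont; first by exists 0.
  exact: compact_box.
exists x; apply/subgrad_iff => z.
have [zN|Nz] := leP `|z| N.
  apply: xmax; rewrite inE => i; rewrite !mxE -ler_norml.
  exact: le_trans (coord_le_norm _ _) zN.
have /xmax : 0 \in B by rewrite inE.
apply: le_trans; have := fC z p; rewrite subrr normr0 => /(_ r0).
have : C + psi_star 0 < r * `|z|.
  rewrite (le_lt_trans (ler_norm _))// mulrC -ltr_pdivrMr//.
rewrite (dotC p 0) dot0l (dotC p z); lra.
Qed.

Lemma subgrad_locally_bounded p : Omega p -> exists2 r, 0 < r &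
  exists M, forall x q, `|q - p| < r -> subgrad x q -> `|x| <= M.
Proof.
move=> Op; have [r r0 [C fC]] := psi_star_coercive Op.
exists r => //; exists ((C + psi_star 0) / r) => x q qp Fxq.
rewrite ler_pdivlMr// mulrC; have := fC x q qp; have := Fxq 0.
rewrite sub0r dotNr (dotC q); lra.
Qed.

Lemma psi_star2_subgrad x p : subgrad x p ->
  psi_star2 Omega phi t p = (dot p x - psi_star x)%:E.
Proof.
move=> /subgrad_iff Fxp; apply/eqP; rewrite eq_le; apply/andP; split.
  apply: ge_ereal_sup => _ [z _ <-].
  by rewrite legendre_psiE -EFinB lee_fin.
by apply: ereal_sup_ubound; exists x => //; rewrite legendre_psiE.
Qed.

Lemma psi_star2_ge x p : ((dot p x - psi_star x)%:E <= psi_star2 Omega phi t p)%E.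
Proof. by apply: ereal_sup_ubound; exists x => //; rewrite legendre_psiE. Qed.

Lemma psi_star2_le p : K p -> (psi_star2 Omega phi t p <= (psr p)%:E)%E.
Proof.
move=> Kp; apply: ge_ereal_sup => _ [z _ <-].
rewrite legendre_psiE -EFinB lee_fin (dotC p); have := psi_star_ge z Kp; lra.
Qed.

(** * Contact between psi_t and its biconjugate *)

Local Notation Theta := (touching_set Omega phi t).

(** At a maximizer z the affine function of slope x meets [psi_t] from below; it also lies below the
    biconjugate, which is squeezed there. *)
Lemma contact_touching x z : K z -> psi_star x = dot x z - psr z ->
  subgrad x z /\ Theta z.
Proof.
move=> Kz fx; have Fxz : subgrad x z.
  by move=> y; have := psi_star_ge y Kz; rewrite fx dotBr !(dotC z); lra.
split=> //; split=> //; rewrite psiE// (psi_star2_subgrad Fxz) fx.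
by congr _%:E; rewrite (dotC z); ring.
Qed.

Lemma touching_contact x p : Theta p -> subgrad x p -> psi_star x = dot x p - psr p.
Proof.
move=> [Kp]; rewrite psiE// => + Fxp; rewrite (psi_star2_subgrad Fxp) => -[->].
by rewrite (dotC p); ring.
Qed.

Definition affine_with p (q : 'rV[R]_d) c := \forall z \near p, phi z = dot q z + c.

Lemma psr_expand p q c s v : phi p = dot q p + c ->
  phi (p + s *: v) = dot q (p + s *: v) + c ->
  psr (p + s *: v) = psr p + s * dot (p + t *: q) v + s * s / 2 * dot v v.
Proof.
move=> phip phiv; rewrite /psi_real phip phiv.
rewrite !(dotDl, dotDr, dotZl, dotZr) (dotC v p); by field.
Qed.

(** At a touching point the supporting affine function of slope x supports [psi_t] itself, whose
    gradient in the affine patch is [p + t *: q]. *)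
Lemma subgrad_touching_affine x p q c : Omega p -> affine_with p q c ->
  Theta p -> subgrad x p -> x = p + t *: q.
Proof.
move=> Op aff Tp Fxp; set y := p + t *: q.
apply/eqP; rewrite -subr_eq0; apply/eqP/dot_eq0; set v := x - y.
have pK : nbhs p [set z | K z /\ phi z = dot q z + c].
  apply: filterI aff; apply: filterS (open_nbhs_nbhs (conj Omega_open Op)).
  exact: subset_closure.
have [e /andP[e0 e1] eK] := nbhs_segment v pK.
have [|Kz phiz] := eK e; first by rewrite lexx ltW.
have phip : phi p = dot q p + c by exact: nbhs_singleton aff.
have := psi_star_ge x Kz; rewrite (psr_expand phip phiz) (touching_contact Tp Fxp).
rewrite -/y dotDr dotZr => h.
have vv : dot v v = dot x v - dot y v by rewrite {1}/v dotBl.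
(* For a move by [e] along [v = x - y], support demands a gain of [e * dot v v] beyond the linear
   part, while the quadratic term grants only [e * e / 2 * dot v v]; with [e <= 1] this leaves
   [v = 0]. *)
have : e * dot v v <= e * e / 2 * dot v v by rewrite [in leLHS]vv; lra.
have := dot_ge0 v => v0.
have [->//|vn0] := eqVneq (dot v v) 0.
have vpos : 0 < dot v v by rewrite lt_neqAle eq_sym vn0.
by rewrite ler_pM2r// => h2; nra.
Qed.

Lemma affine_with_near p q c : affine_with p q c ->
  \forall z \near p, affine_with z q c.
Proof. exact: (@near_join _ p). Qed.

(** The subgradients of one slope form a convex set, which contains the segment from y to p. Its
    points near y still touch in the same affine patch, where the slope determines the point, so the
    segment is trivial. *)
Lemma subgrad_int_touching_affine p y q c : Omega y -> affine_with y q c ->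
  interior Theta y -> subgrad (y + t *: q) p -> p = y.
Proof.
move=> Oy aff iTy Fp; set x := y + t *: q.
have Fy : subgrad x y.
  have [x' Fx'] := exists_subgrad Oy.
  suff -> : x = x' by [].
  exact/esym/(subgrad_touching_affine Oy aff (nbhs_singleton iTy) Fx').
have yU : nbhs y [set z | [/\ Omega z, affine_with z q c & Theta z]].
  have := affine_with_near aff; have := open_nbhs_nbhs (conj Omega_open Oy).
  move=> h1 h2; apply: filterS (filterI h1 (filterI h2 iTy)).
  by move=> z [? []].
have [e /andP[e0 e1] eU] := nbhs_segment (p - y) yU.
have [|Ow affw Tw] := eU e; first by rewrite lexx ltW.
have Fw : subgrad x (y + e *: (p - y)).
  move=> z; have := Fp z; have := Fy z; rewrite -/x !(dotDl, dotZl, dotNl) => h1 h2.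
  nra.
have := subgrad_touching_affine Ow affw Tw Fw; rewrite /x => /addIr/eqP.
rewrite -subr_eq0 opprD addNKr oppr_eq0 scaler_eq0 gt_eqF//= subr_eq0.
by move/eqP.
Qed.

Local Notation star2 := (psi_star2 Omega phi t).

Lemma near_Omega p : Omega p -> \forall q \near p, Omega q.
Proof. by move=> Op; exact: open_nbhs_nbhs. Qed.

Lemma star2_fin p : Omega p -> (star2 p) \is a fin_num.
Proof.
by move=> Op; have [x Fx] := exists_subgrad Op; rewrite (psi_star2_subgrad Fx).
Qed.

Lemma star2_supported x p q : subgrad x p -> Omega q ->
  fine (star2 p) + dot x (q - p) <= fine (star2 q).
Proof.
move=> Fx Oq; rewrite (psi_star2_subgrad Fx)//= dotBr.
have := psi_star2_ge x q.
rewrite -(fineK (star2_fin Oq)) lee_fin (dotC p) (dotC q); lra.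
Qed.

(** Uniqueness, closedness and local boundedness bring every slope y at a nearby q close to x, and
    the remainder at q lies between 0 and [dot (y - x) (q - p)]. *)
Lemma subgrad_differentiable x p : Omega p -> subgrad x p ->
  (forall y, subgrad y p -> y = x) ->
  ereal_differentiable star2 p /\ grad star2 p = x.
Proof.
move=> Op Fx uniq_x.
have [r r0 [M bd]] := subgrad_locally_bounded Op.
have [|du Du] := @diff_of_remainder _ _ (fun z => fine (star2 z)) p x.
  move=> e e0; pose e' := e / (d%:R + 1).
  have d0 : 0 < d%:R + 1 :> R by rewrite ltr_wpDl.
  have e'0 : 0 < e' by rewrite divr_gt0.
  pose C := box (const_mx (- M)) (const_mx M) `&` [set y | e' <= `|y - x|].
  have cC : compact C by apply: compact_annulus; exact: compact_box.
  have avoid : \forall q \near p, forall y, C y -> ~ subgrad y q.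
    apply: image_rel_avoid => //.
      exact: subgrad_closed.
    move=> y [_ /= ye] /uniq_x yx; move: ye.
    by rewrite yx subrr normr0 leNgt e'0.
  have near_r : \forall q \near p, `|q - p| < r by apply/nbhs_rowP; exists r.
  have := near_Omega Op; move: avoid near_r.
  apply: filterS3 => q avq qr Oq.
  have [y Fy] := exists_subgrad Oq.
  have yx : `|y - x| < e'.
    rewrite ltNge; apply/negP => e'y; apply: (avq y _ Fy); split => // i.
    rewrite !mxE -ler_norml (le_trans (coord_le_norm _ _))//.
    exact: bd qr Fy.
  have h1 := star2_supported Fx Oq; have h2 := star2_supported Fy Op.
  rewrite ger0_norm; last lra.
  have : dot (y - x) (q - p) <= e * `|q - p|.
    rewrite (le_trans (ler_norm _))// (le_trans (norm_dot_le _ _))//.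
    rewrite mulrA ler_wpM2r//.
    rewrite (le_trans (ler_wpM2l _ (ltW yx)))//.
    rewrite /e' mulrCA ler_piMr ?(ltW e0)// ler_pdivrMr// mul1r.
    by rewrite lerDl.
  by move: h2; rewrite -(opprB q) dotNr dotBl; lra.
split; first split => //.
  by apply: filterS (near_Omega Op) => q; exact: star2_fin.
by apply/rowP => i; rewrite mxE Du dot_delta.
Qed.

Lemma differentiable_subgrad p : Omega p -> ereal_differentiable star2 p ->
  subgrad (grad star2 p) p.
Proof.
move=> Op [_ du].
have [x Fx] := exists_subgrad Op.
suff -> : grad star2 p = x by [].
apply/rowP => i; rewrite mxE (diff_supported (x := x) du) ?dot_delta//.
by apply: filterS (near_Omega Op) => q; exact: star2_supported.
Qed.

Lemma psi_differentiable p q c : Omega p -> affine_with p q c ->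
  ereal_differentiable psi_t p /\ grad psi_t p = p + t *: q.
Proof.
move=> Op aff; set x := p + t *: q.
have psi_near : \forall z \near p, K z.
  by apply: filterS (near_Omega Op) => z; exact: subset_closure.
have [|du Du] := @diff_of_remainder _ _ (fun z => fine (psi_t z)) p x.
  move=> e e0.
  have d0 : 0 < d%:R + 1 :> R by rewrite ltr_wpDl.
  have near_e : \forall z \near p, `|z - p| < e / (d%:R + 1).
    by apply/nbhs_rowP; exists (e / (d%:R + 1)) => //; rewrite divr_gt0.
  have aff' := aff; move: aff psi_near near_e; apply: filterS3 => z phiz Kz ze.
  have phip : phi p = dot q p + c by exact: nbhs_singleton aff'.
  have zE : z = p + 1 *: (z - p) by rewrite scale1r addrC subrK.
  have Kp : K p by exact: subset_closure.
  rewrite !psiE//= [in psr z]zE (psr_expand phip); last by rewrite -zE.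
  rewrite -/x !mul1r; set v := z - p in ze *.
  rewrite (_ : _ - _ = 2^-1 * dot v v); last by ring.
  rewrite ger0_norm ?mulr_ge0 ?dot_ge0//.
  have v0 : 0 <= `|v| by [].
  have h1 : dot v v <= d%:R * (`|v| * `|v|).
    exact: le_trans (ler_norm _) (norm_dot_le _ _).
  have h2 : (d%:R + 1) * `|v| <= e by rewrite mulrC -ler_pdivlMr// ltW.
  have h3 : (d%:R + 1) * `|v| * `|v| <= e * `|v| by rewrite ler_wpM2r.
  have h4 : 0 <= `|v| * `|v| by rewrite mulr_ge0.
  have := dot_ge0 v; lra.
split; last by apply/rowP => i; rewrite mxE Du dot_delta.
split => //; apply: filterS psi_near => z Kz.
by rewrite psiE.
Qed.

(** Slopes near x keep their subgradients near p, by compactness of the rest of [K]. For w near p,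
    the supremum for the slope [w + t *: q] is thus attained at a touching z in the same affine
    patch; its slope is also [z + t *: q], so [z = w]. *)
Lemma unique_contact_interior p q c : Omega p -> affine_with p q c ->
  Theta p -> subgrad (p + t *: q) p ->
  (forall p', subgrad (p + t *: q) p' -> p' = p) -> interior Theta p.
Proof.
move=> Op aff Tp Fp uniq_p; set x := p + t *: q in Fp uniq_p.
have /nbhs_rowP[e e0 eU] : nbhs p [set z | Omega z /\ affine_with z q c].
  exact: filterI (near_Omega Op) (affine_with_near aff).
pose C := K `&` [set z | e <= `|z - p|].
have cC : compact C by apply: compact_annulus; exact: compact_closure Omega_bounded.
have /nbhs_rowP[s s0 sP] : \forall y \near x, forall z, C z -> ~ subgrad y z.
  apply: (@image_rel_avoid _ _ (fun z y => subgrad y z)) => //.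
    exact: closed_transpose subgrad_closed.
  by move=> z [_ /= ze] /uniq_p zp; move: ze; rewrite zp subrr normr0 leNgt e0.
apply/nbhs_rowP; exists s => // w ws.
have /sP avoid : `|(w + t *: q) - x| < s by rewrite /x opprD addrACA subrr addr0.
have [z Kz fz] := psi_star_attained (w + t *: q).
have [Fz Tz] := contact_touching Kz fz.
have zp : `|z - p| < e.
  by rewrite ltNge; apply/negP => ez; apply: (avoid z _ Fz).
have [Oz affz] := eU z zp.
have := subgrad_touching_affine
  Oz affz Tz Fz.
by move=> /addIr ->.
Qed.

(** * Convexity of phi when every point touches *)

Local Notation A := (affine_set Omega phi).

(** Where phi is affine, the slope along the line is [c * r] plus a constant, with [c = dot e e];
    [slope_gap] carries this growth across the null set, and it pays exactly for the quadratic part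
    of [psi_t]. *)
Lemma phi_convex_line p e : Omega `<=` Theta ->
  (forall s, 0 <= s <= 1 -> Omega (p + s *: e)) ->
  lebesgue [set v : 'rV[R]_1 | (Omega `\` A) (p + v ord0 ord0 *: e)] = 0%E ->
  forall s, 0 <= s <= 1 -> phi (p + s *: e) <= (1 - s) * phi p + s * phi (p + e).
Proof.
move=> OT Oe null_A s s01.
have [->|e_neq0] := eqVneq e 0.
  by rewrite scaler0 addr0 -mulrDl subrK mul1r.
pose c := dot e e.
have c_gt0 : 0 < c.
  rewrite lt_neqAle dot_ge0 andbT eq_sym; apply: contra e_neq0 => /eqP c0.
  by apply/eqP/dot_eq0.
have /choice[x xP] (r : R) : exists x, 0 <= r <= 1 -> subgrad x (p + r *: e).
  have [r01|r01] := boolP (0 <= r <= 1); last by exists 0.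
  by have [x Fx] := exists_subgrad (Oe r r01); exists x.
pose X r := dot (x r) e.
have X_mono r u : 0 <= r <= 1 -> 0 <= u <= 1 -> 0 <= (X u - X r) * (u - r).
  move=> r01 u01; have := subgrad_monotone (xP u u01) (xP r r01).
  have -> : p + u *: e - (p + r *: e) = (u - r) *: e.
    by rewrite opprD addrACA subrr add0r scalerBl.
  by rewrite dotZr dotBl mulrC.
have X_nd r u : 0 <= r -> r <= u -> u <= 1 -> X r <= X u.
  move=> r0 ru u1; have [->//|ru'] := eqVneq r u.
  have ru_lt : r < u by rewrite lt_neqAle ru'.
  have := X_mono r u; rewrite r0 u1 (le_trans ru u1) (le_trans r0 ru).
  by move=> /(_ isT isT); rewrite pmulr_lge0 ?subr_gt0// subr_ge0.
have X_affine r : 0 < r < 1 -> A (p + r *: e) -> affine_slope X c r.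
  move=> r01 [_ [q [k aff]]].
  exists (dot (p + t *: q) e).
  have near01 : \forall r' \near r, 0 <= r' <= 1.
    move/andP: r01 => [r0 r1].
    have h1 : \forall r' \near r, 0 < r' by exact: lt_nbhsr.
    have h2 : \forall r' \near r, r' < 1 by exact: lt_nbhsl.
    by apply: filterS2 h1 h2 => r' /ltW -> /ltW ->.
  have ce : continuous (fun r : R => p + r *: e).
    apply: continuous_rowD; first exact: cst_continuous.
    by apply: continuous_rowZ; [move=> ?|exact: cst_continuous].
  have near_aff : \forall r' \near r, affine_with (p + r' *: e) q k.
    exact: (ce r _ (affine_with_near aff)).
  apply: filterS2 near01 near_aff => r' r'01 aff'.
  have Or' := Oe r' r'01.
  rewrite /X (subgrad_touching_affine Or' aff' (OT _ Or') (xP _ r'01)).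
  by rewrite addrAC [LHS]dotDl [X in _ + X]dotZl /c; ring.
have affine_ae : lebesgue [set v : 'rV[R]_1 |
    0 < v ord0 ord0 < 1 /\ ~ affine_slope X c (v ord0 ord0)] = 0%E.
  apply: (lebesgue_sub0 _ null_A) => v [v01 nv]; split => [|Av].
    by apply: Oe; have /andP[/ltW -> /ltW ->] := v01.
  by apply: nv; exact: X_affine.
have gap := slope_gap c_gt0 X_nd affine_ae.
pose G r := fine (star2 (p + r *: e)).
have GE r : 0 <= r <= 1 -> G r = psr (p + r *: e).
  by move=> r01; have [Kr] := OT _ (Oe r r01); rewrite /G psiE// => <-.
have G_ge r u : 0 <= r <= 1 -> 0 <= u <= 1 -> G r + X r * (u - r) <= G u.
  move=> r01 u01; have := star2_supported (xP r r01) (Oe u u01).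
  by rewrite opprD addrACA subrr add0r -scalerBl dotZr mulrC.
have X_gap r u : 0 <= r <= 1 -> 0 <= u <= 1 ->
    c * (u - r) ^+ 2 <= (X u - X r) * (u - r).
  move=> /andP[r0 r1] /andP[u0 u1]; have [ru|ur|->] := ltgtP r u.
  - rewrite expr2 mulrA; apply: ler_wpM2r; first by rewrite subr_ge0 ltW.
    exact: gap.
  - rewrite (_ : _ ^+ 2 = (r - u) * (r - u)); last by ring.
    rewrite (_ : (X u - X r) * (u - r) = (X r - X u) * (r - u)); last by ring.
    rewrite mulrA.
    apply: ler_wpM2r; first by rewrite subr_ge0 ltW.
    exact: gap.
  - by rewrite subrr expr0n mulr0 mulr0.
have strong := strongly_convex_segment (ltW c_gt0) G_ge X_gap.
have r0 : 0 <= (0 : R) <= 1 by rewrite lexx ler01.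
have r1 : 0 <= (1 : R) <= 1 by rewrite lexx ler01.
(* Weighted by [1 - s] and [s], the two inequalities cancel the slope term, and their gain
   [c / 2 * s * (1 - s)] is that of the quadratic part; t times the claim remains. *)
have := strong s 0 s01 r0; have := strong s 1 s01 r1.
rewrite !GE// scale0r addr0 scale1r /psi_real.
have E r : dot (p + r *: e) (p + r *: e) = dot p p + 2 * r * dot p e + r * r * c.
  by rewrite dotDl !dotDr !dotZl !dotZr (dotC e p) /c; ring.
have E1 : dot (p + e) (p + e) = dot p p + 2 * dot p e + c.
  by have := E 1; rewrite scale1r => ->; ring.
rewrite E E1; move/andP: s01 => [s0 s1]; set a := X s; set P := dot p p; set Q := dot p e.
set f0 := phi p; set f1 := phi (p + e); set fs := phi _ => h1 h0.
have s1' : 0 <= 1 - s by rewrite subr_ge0.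
have g0 := ler_wpM2l s1' h0; have g1 := ler_wpM2l s0 h1.
rewrite -(ler_pM2l t_gt0); lra.
Qed.

Lemma within_near (f : 'rV[R]_d -> R) x (e : R) :
  {within K, continuous f} -> K x -> 0 < e ->
  \forall z \near x, K z -> `|f x - f z| < e.
Proof.
move=> cf Kx e0; have /cvgrPdist_lt/(_ e e0) := @cf x.
move=> h; suff : within K (nbhs x) [set z | `|f x - f z| < e] by [].
by rewrite nbhs_subspace_in//; exact: h.
Qed.

Lemma open_affine_set : open A.
Proof.
rewrite openE => p [Op [q [c aff]]].
apply: filterS2 (near_Omega Op) (affine_with_near aff) => p' Op' aff'.
by split => //; exists q, c.
Qed.

(** A failure of convexity survives small perturbations of the segment: the endpoints are pulled
    into [Omega] and then shifted by a common w that makes [phi_convex_line] applicable. *)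
Lemma phi_convex_of_touching : Omega `<=` Theta -> lebesgue (Omega `\` A) = 0%E ->
  forall x y s, K x -> K y -> 0 <= s <= 1 ->
    phi ((1 - s) *: x + s *: y) <= (1 - s) * phi x + s * phi y.
Proof.
move=> OT NA x y s Kx Ky s01; rewrite leNgt; apply/negP => lt.
set m : 'rV[R]_d := (1 - s) *: x + s *: y in lt.
have Km : K m by exact: closure_convex.
(* Half the defect: one [e] is spent at the intermediate point, the other on the average of the
   endpoints. *)
pose e := (phi m - ((1 - s) * phi x + s * phi y)) / 2.
have e0 : 0 < e by rewrite divr_gt0// subr_gt0.
have /nbhs_rowP[rx rx0 xP] := within_near phi_continuous Kx e0.
have /nbhs_rowP[ry ry0 yP] := within_near phi_continuous Ky e0.
have /nbhs_rowP[rm rm0 mP] := within_near phi_continuous Km e0.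
pose r := Num.min rx (Num.min ry rm).
have r0 : 0 < r by rewrite !lt_min rx0 ry0.
have r20 : 0 < r / 2 by rewrite divr_gt0.
have [c Oc] := Omega_neq0.
have nb z : nbhs z [set w : 'rV[R]_d | `|w - z| < r / 2].
  by apply/nbhs_rowP; exists (r / 2).
have [e1 /andP[e10 e11] e1P] := nbhs_segment (c - x) (nb x).
have [e2 /andP[e20 e21] e2P] := nbhs_segment (c - y) (nb y).
pose h := Num.min e1 e2.
have h0 : 0 < h by rewrite lt_min e10.
have h1 : h <= 1 by rewrite ge_min e11.
have inO z : K z -> Omega (z + h *: (c - z)).
  move=> Kz; have := convex_open_closure Omega_open Omega_convex Kz Oc (s := h).
  rewrite h0 h1 => /(_ isT); congr Omega; apply/rowP => i; rewrite !mxE; ring.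
pose p := x + h *: (c - x); pose z := y + h *: (c - y).
have px : `|p - x| < r / 2 by apply: e1P; rewrite ltW//= ge_min lexx.
have zy : `|z - y| < r / 2 by apply: e2P; rewrite ltW//= ge_min lexx orbT.
have Op : Omega p by exact: inO. have Oz : Omega z by exact: inO.
have /nbhs_rowP[rp rp0 pO] := near_Omega Op.
have /nbhs_rowP[rz rz0 zO] := near_Omega Oz.
(* Half of [r] is spent on the inward move; the other half bounds w, which must also keep both
   endpoints in [Omega]. *)
pose rw := Num.min (r / 2) (Num.min rp rz).
have rw0 : 0 < rw by rewrite !lt_min r20 rp0.
pose W : set 'rV[R]_d := [set w | `|w| < rw].
have oW : open W.
  apply: (@open_comp _ _ (fun w : 'rV[R]_d => `|w|)) (@open_lt R _).
  by move=> w _; exact: norm_continuous.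
have W_gt0 : (0 < lebesgue W)%E.
  by apply: lebesgue_open_gt0 => //; exists 0; rewrite /W /= normr0.
have mN : measurable (Omega `\` A : set (borelRd R d)).
  by apply: measurableD; apply: measurable_open => //; exact: open_affine_set.
have [w Ww null_w] := exists_null_line p (z - p) mN NA W_gt0.
move: Ww; rewrite /W /= /rw !lt_min => /andP[wr /andP[wp wz]].
have Opw : Omega (p + w) by apply: pO; rewrite addrC addKr.
have Ozw : Omega (z + w) by apply: zO; rewrite addrC addKr.
have zwE : p + w + (z - p) = z + w by rewrite addrAC subrKC.
have segE r' : p + w + r' *: (z - p) = (1 - r') *: (p + w) + r' *: (z + w).
  by apply/rowP => i; rewrite !mxE; ring.
have := phi_convex_line OT _ null_w s01; rewrite zwE.
have seg r' : 0 <= r' <= 1 -> Omega (p + w + r' *: (z - p)).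
  by move=> r'01; rewrite segE; exact: convex_setP.
move=> /(_ seg).
have bound u v : `|u - v| < r / 2 -> `|u + w - v| < r.
  move=> uv; rewrite addrAC (le_lt_trans (ler_normD _ _))//.
  lra.
have /xP : `|p + w - x| < rx by rewrite (lt_le_trans (bound _ _ px))// /r ge_min lexx.
move=> /(_ (subset_closure Opw)).
have /yP : `|z + w - y| < ry.
  by rewrite (lt_le_trans (bound _ _ zy))// /r !ge_min lexx orbT.
move=> /(_ (subset_closure Ozw)).
have /mP : `|p + w + s *: (z - p) - m| < rm.
  apply: (@lt_le_trans _ _ r); last by rewrite /r !ge_min lexx !orbT.
  have -> : p + w + s *: (z - p) - m = (1 - s) *: (p - x) + s *: (z - y) + w - 0.
    by apply/rowP => i; rewrite /m !mxE; ring.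
  apply: bound; rewrite subr0 (le_lt_trans (ler_normD _ _))// !normrZ.
  move/andP: s01 => [s0 s1]; rewrite !ger0_norm ?subr_ge0//.
  have [->|sn0] := eqVneq s 0; first by rewrite subr0 mul1r mul0r addr0.
  have sgt : 0 < s by rewrite lt_neqAle eq_sym sn0.
  have a1 : s * `|z - y| < s * (r / 2) by rewrite ltr_pM2l.
  have a2 : (1 - s) * `|p - x| <= (1 - s) * (r / 2).
    by rewrite ler_wpM2l ?subr_ge0// ltW.
  lra.
move=> /(_ (subset_closure (seg s s01))).
rewrite !ltr_norml => /andP[m1 m2] /andP[y1 y2] /andP[x1 x2] cvx.
move/andP: s01 => [s0 s1].
have b1 : (1 - s) * phi (p + w) <= (1 - s) * (phi x + e).
  by rewrite ler_wpM2l ?subr_ge0//; lra.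
have b2 : s * phi (z + w) <= s * (phi y + e) by rewrite ler_wpM2l//; lra.
have : e * 2 = phi m - ((1 - s) * phi x + s * phi y) by rewrite /e divfK.
lra.
Qed.

(** Turns one untouched point into a set of positive measure. Slopes are bounded near p, so the
    biconjugate rises by less than half the gap, and continuity keeps [psi_t] from falling by the
    other half. *)
Lemma open_not_touching : open (Omega `\` Theta).
Proof.
rewrite openE => p [Op nTp]; have Kp : K p by exact: subset_closure.
have lt_p : fine (star2 p) < psr p.
  have := psi_star2_le Kp; rewrite -(fineK (star2_fin Op)) lee_fin le_eqVlt.
  case/predU1P => // E; exfalso; apply: nTp; split => //.
  by rewrite psiE// -E fineK// star2_fin.
pose e := (psr p - fine (star2 p)) / 2.
have e0 : 0 < e by rewrite divr_gt0// subr_gt0.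
have [r r0 [M bd]] := subgrad_locally_bounded Op.
pose L := d%:R * `|M| + 1.
have L0 : 0 < L by rewrite ltr_wpDl// mulr_ge0.
have near_r : \forall q \near p, `|q - p| < Num.min r (e / L).
  apply/nbhs_rowP; exists (Num.min r (e / L)) => //.
  by rewrite lt_min r0 divr_gt0.
apply: filterS3 (near_Omega Op) near_r (within_near psi_real_continuous Kp e0).
move=> q Oq; rewrite lt_min => /andP[qr qe] psrq; split => // -[Kq].
rewrite psiE// -(fineK (star2_fin Oq)) => -[Tq].
have [y Fy] := exists_subgrad Oq.
have := star2_supported Fy Op; have := psrq Kq; rewrite ltr_norml Tq.
have h : dot y (q - p) < e.
  rewrite (le_lt_trans (ler_norm _))// (le_lt_trans (norm_dot_le _ _))//.
  apply: (@le_lt_trans _ _ (L * `|q - p|)); last by rewrite mulrC -ltr_pdivlMr.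
  rewrite mulrA ler_wpM2r// (@le_trans _ _ (d%:R * `|M|))// ?lerDl//.
  by rewrite ler_wpM2l// (le_trans (bd _ _ qr Fy))// ler_norm.
have h2 : dot y (p - q) = - dot y (q - p) by rewrite -dotNr opprB.
have h3 : e * 2 = psr p - fine (star2 p) by rewrite /e divfK.
move=> /andP[? ?]; rewrite h2; lra.
Qed.

(** * Slopes of the regular and singular regions *)

Local Notation B_t := (B_set Omega phi t).
Local Notation S_t := (S_set Omega phi t).
Local Notation contact_set := (A `&` interior Theta).

Lemma affine_setP p : A p -> Omega p /\ exists q c, affine_with p q c.
Proof. by move=> [Op [q [c aff]]]; split => //; exists q, c. Qed.

Lemma B_setE : B_t = grad psi_t @` contact_set.
Proof.
rewrite /B_set /grad_image; congr (_ @` _); apply/setIidPl => p [Ap _] /=.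
have [Op [q [c aff]]] := affine_setP Ap.
by have [] := psi_differentiable Op aff.
Qed.

Lemma contact_subgrad p : contact_set p -> subgrad (grad psi_t p) p.
Proof.
move=> [Ap iTp]; have [Op [q [c aff]]] := affine_setP Ap.
have [_ ->] := psi_differentiable Op aff.
have [x Fx] := exists_subgrad Op.
by rewrite -(subgrad_touching_affine Op aff (nbhs_singleton iTp) Fx).
Qed.

Lemma contact_unique_slope p x : contact_set p -> subgrad x p -> x = grad psi_t p.
Proof.
move=> [Ap iTp] Fx; have [Op [q [c aff]]] := affine_setP Ap.
have [_ ->] := psi_differentiable Op aff.
exact: subgrad_touching_affine Op aff (nbhs_singleton iTp) Fx.
Qed.

Lemma contact_unique_point p p' : contact_set p -> subgrad (grad psi_t p) p' ->
  p' = p.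
Proof.
move=> [Ap iTp]; have [Op [q [c aff]]] := affine_setP Ap.
have [_ ->] := psi_differentiable Op aff.
exact: subgrad_int_touching_affine Op aff iTp.
Qed.

Lemma S_setP x : S_t x <-> exists p, [/\ A p, ~ interior Theta p,
  ereal_differentiable star2 p, grad star2 p = x & subgrad x p].
Proof.
split => [[p [[Ap nTp] dp] <-]|[p [Ap nTp dp gp _]]]; last by exists p.
exists p; split => //; apply: differentiable_subgrad => //.
by have [] := affine_setP Ap.
Qed.

Lemma B_S_disjoint : B_t `&` S_t = set0.
Proof.
rewrite -subset0 B_setE => x [[y cy <-] /S_setP[p [_ nTp _ _ Fp]]].
by apply: nTp; rewrite (contact_unique_point cy Fp); have [] := cy.
Qed.

Local Notation multi_slope := (multi_image subgrad).
Local Notation multi_point := (multi_image (fun p x => subgrad x p)).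

Lemma subgrad_monotone_transpose p x q y : subgrad x p -> subgrad y q ->
  0 <= dot (p - q) (x - y).
Proof. by move=> Fx Fy; rewrite dotC; exact: subgrad_monotone. Qed.

Lemma multi_slope0 : lebesgue multi_slope = 0%E.
Proof. exact: (lebesgue_multi_image subgrad_closed subgrad_monotone). Qed.

Lemma multi_point0 : lebesgue multi_point = 0%E.
Proof.
exact: (lebesgue_multi_image (closed_transpose subgrad_closed)
  subgrad_monotone_transpose).
Qed.

Lemma measurable_multi_point : measurable (multi_point : set (borelRd R d)).
Proof.
exact: (measurable_multi_image (closed_transpose subgrad_closed)).
Qed.

(** If p were the only subgradient for x, it would be the maximizer for x, hence touching, and
    [unique_contact_interior] would place it in the interior. *)
Lemma S_multi_point : S_t `<=` multi_point.
Proof.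
move=> x /S_setP[p [Ap nTp _ _ Fp]]; have [Op [q [c aff]]] := affine_setP Ap.
apply: contrapT => nx; apply: nTp.
have uniq_p p' : subgrad x p' -> p' = p.
  by move=> Fp'; apply: contrapT => pp'; apply: nx; exists p', p.
have [z Kz fz] := psi_star_attained x; have [Fz Tz] := contact_touching Kz fz.
have Tp : Theta p by rewrite -(uniq_p z Fz).
have xE := subgrad_touching_affine Op aff Tp Fp.
by move: Fp uniq_p; rewrite xE; exact: unique_contact_interior Op aff Tp.
Qed.

Lemma subgrad_S x p : A p -> ~ interior Theta p -> subgrad x p ->
  ~ multi_slope p -> S_t x.
Proof.
move=> Ap nTp Fx np; have [Op _] := affine_setP Ap.
have [|dp gp] := subgrad_differentiable Op Fx; last first.
  by apply/S_setP; exists p.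
by move=> y Fy; apply: contrapT => yx; apply: np; exists y, x.
Qed.

Lemma kappaE E : kappa Omega phi t E = lebesgue (image_rel subgrad E).
Proof.
rewrite /kappa /monge_ampere; congr lebesgue.
apply/seteqP; split => [p [x Ex]|p [x Ex Fx]].
  by rewrite subdifferentialE => Fx; exists x.
by exists x => //; rewrite subdifferentialE.
Qed.

(** * The decomposition of the Monge-Ampere measure *)

Hypothesis phi_affine : lebesgue (Omega `\` A) = 0%E.

Local Notation exceptional :=
  (multi_slope `|` ((closure Omega `\` Omega) `|` (Omega `\` A))).

Lemma exceptional0 : lebesgue exceptional = 0%E.
Proof.
apply: lebesgue_setU0; first exact: multi_slope0.
by apply: lebesgue_setU0 => //; exact: lebesgue_boundary0.
Qed.

Lemma kappa_S_gt0 : (exists2 p, Omega p & ~ Theta p) -> (0 < kappa Omega phi t S_t)%E.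
Proof.
move=> [p Op nTp]; rewrite kappaE.
have := lebesgue_open_gt0 open_not_touching (ex_intro _ p (conj Op nTp)).
move=> /lt_le_trans; apply.
apply: (@le_trans _ _ (lebesgue (image_rel subgrad S_t `|` exceptional))).
  apply: le_lebesgue => q [Oq nTq].
  have [x Fx] := exists_subgrad Oq.
  have [Aq|nAq] := pselect (A q); last by right; right; right.
  have [mq|mq] := pselect (multi_slope q); first by right; left.
  left; exists x => //; apply: subgrad_S Aq _ Fx mq => iTq.
  exact: nTq (nbhs_singleton iTq).
by rewrite (le_trans (lebesgueU_le _ _))// exceptional0 adde0.
Qed.

Local Notation D E := (image_rel subgrad E `\` multi_slope).

Lemma lebesgue_D E : lebesgue (D E) = kappa Omega phi t E.
Proof.
rewrite kappaE; apply: (eq_lebesgue_mod0 multi_slope0); first by move=> p []; left.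
by move=> p Ep; have [?|?] := pselect (multi_slope p); [right|left].
Qed.

(** Off [multi_slope] the slope is unique, so one slope in E and one in S are the same. The
    restriction to S thereby becomes a fixed set cut by [D E], the form that [measure_lebesgue_setI]
    needs. *)
Lemma lebesgue_D_setI E S :
  lebesgue (image_rel subgrad S `&` D E) = kappa Omega phi t (E `&` S).
Proof.
rewrite -lebesgue_D; congr lebesgue; apply/seteqP; split.
  move=> p [[x Sx Fx] [[y Ey Fy] np]]; split => //; exists x => //; split => //.
  suff -> : x = y by [].
  by apply: contrapT => xy; apply: np; exists x, y.
by move=> p [[x [Ex Sx] Fx] np]; split; [exists x|split => //; exists x].
Qed.

Lemma grad_psi_contact_hom p : contact_set p ->
  exists c, \forall y \near p, grad psi_t y = y + c.
Proof.
move=> [Ap _]; have [Op [q [c aff]]] := affine_setP Ap; exists (t *: q).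
apply: filterS2 (near_Omega Op) (affine_with_near aff) => y Oy affy.
by have [] := psi_differentiable Oy affy.
Qed.

Lemma open_contact : open contact_set.
Proof. by apply: openI; [exact: open_affine_set|exact: open_interior]. Qed.

Lemma grad_psi_inj : {in contact_set &, injective (grad psi_t)}.
Proof.
move=> p p'; rewrite !inE => cp cp' E.
by apply: contact_unique_point cp' _; rewrite -E; exact: contact_subgrad.
Qed.

(** On the contact set the gradient inverts the relation and is an injective local translation,
    which preserves the measure of arbitrary subsets. *)
Lemma lebesgue_D_contact E : lebesgue (D E `&` contact_set) = lebesgue (E `&` B_t).
Proof.
have -> : E `&` B_t = grad psi_t @` (D E `&` contact_set).
  rewrite B_setE; apply/seteqP; split => [x [Ex [y cy yE]]|_ [y [[[x Ex Fx] _] cy] <-]].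
    exists y => //; split => //; split.
      by exists (grad psi_t y); [rewrite yE|exact: contact_subgrad].
    move=> [x1 [x2 [x12 F1 F2]]]; apply: x12.
    by rewrite (contact_unique_slope cy F1) (contact_unique_slope cy F2).
  have xE := contact_unique_slope cy Fx.
  by split; [rewrite -xE|exists y].
rewrite (@lebesgue_piecewise_hom _ _ 1 contact_set) ?expr1n ?mul1e//.
- exact: open_contact.
- exact: grad_psi_inj.
- move=> p /grad_psi_contact_hom[c pc]; exists c.
  by apply: filterS pc => y ->; rewrite scale1r.
Qed.

(** Off the contact set a nonexceptional p has its slope in [S_set]; conversely, a contact point
    with slope in [S_set] would contradict [B_S_disjoint]. *)
Lemma lebesgue_D_singular E :
  lebesgue (D E `&` ~` contact_set) = kappa Omega phi t (E `&` S_t).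
Proof.
rewrite -lebesgue_D; apply: (eq_lebesgue_mod0 exceptional0).
  move=> p [[[x Ex Fx] np] ncp].
  have [Op|nOp] := pselect (Omega p); last first.
    by right; right; left; split => //; exact: subgrad_closure Fx.
  have [Ap|nAp] := pselect (A p); last by right; right; right.
  left; split => //; exists x => //; split => //; apply: (subgrad_S Ap _ Fx np) => iTp.
  by apply: ncp; split.
move=> p [[x [Ex Sx] Fx] np]; left; split; first by split => //; exists x.
move=> cp; have : (B_t `&` S_t) x.
  by split => //; rewrite B_setE (contact_unique_slope cp Fx); exists p.
by rewrite B_S_disjoint.
Qed.

(** The contact set is open, hence a Caratheodory set that cuts [D E] into the two parts just
    computed. *)
Lemma kappa_split E : measurable (E : set (borelRd R d)) ->
  kappa Omega phi t E = (lebesgue (E `&` B_t) + kappa Omega phi t (E `&` S_t))%E.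
Proof.
move=> mE; rewrite -lebesgue_D -lebesgue_D_contact -lebesgue_D_singular.
by apply: lebesgue_caratheodory; apply: measurable_open; exact: open_contact.
Qed.

Lemma D_measure Y : exists mu : {measure set (borelRd R d) -> \bar R},
  forall E, mu E = lebesgue (Y `&` D E).
Proof.
apply: (@measure_lebesgue_setI _ _ (fun E => D E) Y).
- by apply/seteqP; split => // p [[x []]].
- move=> E mE; apply: lebesgue_caratheodory.
  apply: measurable_image_rel_mod => //; exact: subgrad_closed.
- exact: image_rel_mod_bigcup.
- exact: image_rel_mod_disjoint.
Qed.

Lemma monge_ampere_decomposition : (exists2 p, Omega p & ~ Theta p) ->
  let kappa_t := kappa Omega phi t in
  [/\ exists kap mu nu : {measure set (borelRd R d) -> \bar R},
        [/\ forall E, measurable E ->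
              [/\ kap E = kappa_t E,
                  mu E = lebesgue (E `&` B_t),
                  nu E = kappa_t (E `&` S_t) &
                  kap E = (mu E + nu E)%E],
            forall N, measurable N -> lebesgue N = 0%E -> mu N = 0%E &
            exists N, [/\ measurable N, lebesgue N = 0%E & nu (~` N) = 0%E]],
      B_t `&` S_t = set0,
      [/\ forall x, contact_set x -> ereal_differentiable psi_t x,
          set_bij contact_set B_t (grad psi_t) &
          forall x, contact_set x ->
            exists c, \forall y \near x, grad psi_t y = y + c] &
      lebesgue S_t = 0%E /\ (0 < kappa_t S_t)%E].
Proof.
move=> not_touching kappa_t; split.
- have [kap kapE] := D_measure setT; have [nu nuE] := D_measure (image_rel subgrad S_t).
  have [||||mu muE] := @measure_lebesgue_setI R d id B_t; try by [].
    by move=> E; exact: lebesgue_caratheodory.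
  have kapK E : kap E = kappa_t E by rewrite kapE setTI lebesgue_D.
  have muB E : mu E = lebesgue (E `&` B_t) by rewrite muE setIC.
  have nuS E : nu E = kappa_t (E `&` S_t) by rewrite nuE lebesgue_D_setI.
  exists kap, mu, nu; split.
  + by move=> E mE; split => //; rewrite kapK muB nuS; exact: kappa_split.
  + by move=> N _ N0; rewrite muB; exact: lebesgue_sub0 (@subIsetl _ N B_t) N0.
  (* The carrier of [nu] is this Borel null set, of which [S_set] is a subset. *)
  + exists multi_point; split.
    * exact: measurable_multi_point.
    * exact: multi_point0.
    rewrite nuS; have -> : ~` multi_point `&` S_t = set0.
      by rewrite -subset0 => x [nx /S_multi_point].
    rewrite /kappa_t kappaE; have -> : image_rel subgrad set0 = set0.
      by rewrite -subset0 => p [].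
    exact: lebesgue_set0.
- exact: B_S_disjoint.
- split.
  + move=> p [Ap _]; have [Op [q [c aff]]] := affine_setP Ap.
    by have [] := psi_differentiable Op aff.
  + rewrite B_setE; split; first by move=> p cp; exists p.
    * exact: grad_psi_inj.
    * by move=> x [p cp <-]; exists p.
  + exact: grad_psi_contact_hom.
- split; last exact: kappa_S_gt0.
  exact: lebesgue_sub0 S_multi_point multi_point0.
Qed.

End Potential.

Theorem theorem6p5 (R : realType) (d : nat)
    (Omega : set 'rV[R]_d) (phi : 'rV[R]_d -> R) (t : R)
    (Omega_open : open Omega) (Omega_bounded : bounded_set Omega)
    (Omega_convex : convex_set Omega)
    (phi_continuous : {within closure Omega, continuous phi})
    (phi_affine : locally_affine_ae Omega phi)
    (phi_nonconvex : ~ convex_function (closure Omega) phi)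
    (t_gt0 : 0 < t) :
  let A := affine_set Omega phi in
  let psi_t := psi Omega phi t in
  let Theta_t := touching_set Omega phi t in
  let B_t := B_set Omega phi t in
  let S_t := S_set Omega phi t in
  let kappa_t := kappa Omega phi t in
  [/\ exists kap mu nu : {measure set (borelRd R d) -> \bar R},
        [/\ forall E, measurable E ->
              [/\ kap E = kappa_t E,
                  mu E = lebesgue (E `&` B_t),
                  nu E = kappa_t (E `&` S_t) &
                  kap E = (mu E + nu E)%E],
            forall N, measurable N -> lebesgue N = 0%E -> mu N = 0%E &
            exists N, [/\ measurable N, lebesgue N = 0%E & nu (~` N) = 0%E]],
      B_t `&` S_t = set0,
      [/\ forall x, (A `&` interior Theta_t) x -> ereal_differentiable psi_t x,
          set_bij (A `&` interior Theta_t) B_t (grad psi_t) &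
          forall x, (A `&` interior Theta_t) x ->
            exists c, \forall y \near x, grad psi_t y = y + c] &
      lebesgue S_t = 0%E /\ (0 < kappa_t S_t)%E].
Proof.
move=> A psi_t Theta_t B_t S_t kappa_t.
(* Every function is convex on an empty domain, so non-convexity supplies a point. *)
have Omega_neq0 : Omega !=set0.
  apply: contrapT => O0; suff : convex_function (closure Omega) phi by [].
  move=> k x y; rewrite inE => cx.
  by have [z [Oz _]] := cx _ filterT; exfalso; apply: O0; exists z.
have not_touching : exists2 p, Omega p & ~ Theta_t p.
  apply: contrapT => all_touching.
  suff : convex_function (closure Omega) phi by [].
  move=> k x y; rewrite !inE => Kx Ky.
  have OT : Omega `<=` Theta_t.
    move=> p Op; apply: contrapT => nTp; apply: all_touching.
    by exists p.
  have k01 : 0 <= k%:num <= 1 by apply/andP; split.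
  (* The two points are swapped because the convex combination puts the weight [k] on its first
     argument. *)
  have := phi_convex_of_touching Omega_open Omega_bounded Omega_convex
    phi_continuous Omega_neq0 t_gt0 OT phi_affine Ky Kx k01.
  by rewrite addrC [X in _ <= X -> _]addrC.
exact: monge_ampere_decomposition.
Qed.
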